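(* Let $\gamma\in(0,\sqrt2)$ and let $\mu_{\gamma,\mathrm{GMC}}$ be the standard sub-critical Gaussian multiplicative chaos measure on $[0,1]$ with parameter $\gamma$. Let $D_\gamma=1-\gamma^2$ if $0<\gamma<\sqrt2/2$ and $D_\gamma=(\sqrt2-\gamma)^2$ if $\sqrt2/2\le\gamma<\sqrt2$. Then, almost surely, $\mu_{\gamma,\mathrm{GMC}}$ is $\alpha$-upper Frostman regular for every $0\le\alpha<D_\gamma/2$.
   Context: A non-negative Borel measure $\nu$ on $\mathbb R$ is $\alpha$-upper Frostman regular if $\sup\{\nu(I)/|I|^\alpha: I \text{ a finite interval of }\mathbb R\}<\infty$ (intervals of positive length $|I|$; a measure on $[0,1]$ is viewed as a measure on $\mathbb R$). GMC measure. On $\mathbb R\times\mathbb R_+$ let $\lambda(A)=\int_A y^{-2}\,\mathrm dx\,\mathrm dy$. Let $W$ be the white noise with control measure $\lambda$: a centered Gaussian family indexed by Borel sets $A$ with $\lambda(A)<\infty$, with $\mathbb E[W(A)W(B)]=\lambda(A\cap B)$. For $m\ge0$ and $t\in[0,1]$ put \[ \mathcal C_m(t)=\{(x,y)\in\mathbb R\times\mathbb R_+: y>\max\{2|x-t|,2^{-m}\},\ |x-t|<1/2\},\qquad \psi_m(t)=W(\mathcal C_m(t)), \] using versions continuous in $t$. Let $\mu_{\gamma,m}(\mathrm dt)=\exp\big(\gamma\psi_m(t)-\frac{\gamma^2}{2}\mathbb E[\psi_m(t)^2]\big)\mathrm dt$ on $[0,1]$. Almost surely, as $m\to\infty$, $\mu_{\gamma,m}$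 converges weakly to a random measure; the limit is $\mu_{\gamma,\mathrm{GMC}}$ (known from Kahane's theory). *)

(* Defs.v *)
From HB Require Import structures.
From mathcomp Require Import all_boot all_order all_algebra.
From mathcomp Require Import all_classical all_reals all_analysis.

Set Implicit Arguments.
Unset Strict Implicit.
Unset Printing Implicit Defensive.

Import Order.TTheory GRing.Theory Num.Theory.
Import numFieldNormedType.Exports.

Local Open Scope classical_set_scope.
Local Open Scope ring_scope.

(* In all integrals and measures below, the real line carries its Borel
   sigma-algebra [measurableTypeR R] and the plane the product sigma-algebra. *)

Section frostman.
Variable R : realType.

(* The Booleans [ba] and [bb] decide whether the endpoints are included, so
   that the supremum is over all bounded intervals of positive length. *)
Definition upper_frostman_ratios (alpha : R) (nu : set R -> \bar R) :
    set (\bar R) :=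
  [set x | exists (a b : R) (ba bb : bool), a < b /\
    x = (nu [set` Interval (BSide ba a) (BSide bb b)] *
         ((b - a) `^ alpha)^-1%:E)%E].

Definition upper_frostman_regular (alpha : R) (nu : set R -> \bar R) : Prop :=
  (ereal_sup (upper_frostman_ratios alpha nu) < +oo)%E.

Definition D_gamma (gamma : R) : R :=
  if gamma < Num.sqrt 2 / 2 then 1 - gamma ^+ 2
  else (Num.sqrt 2 - gamma) ^+ 2.

Definition weakly_converges (nu_ : nat -> set (measurableTypeR R) -> \bar R)
    (nu : set (measurableTypeR R) -> \bar R) : Prop :=
  (nu setT < +oo)%E /\
  forall f : R -> R, continuous f -> (exists M : R, forall x, `|f x| <= M) ->
    (\int[nu_ m]_x (f x)%:E @[m --> \oo] --> \int[nu]_x (f x)%:E)%E.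

End frostman.

Section white_noise.
Context {R : realType}.
Local Notation plane := (measurableTypeR R * measurableTypeR R)%type.

Definition control_measure (A : set plane) : \bar R :=
  (\int[lebesgue_measure \x lebesgue_measure]_(z in A) (z.2 ^- 2)%:E)%E.

Definition admissible (A : set plane) : Prop :=
  [/\ measurable A, A `<=` [set z | 0 < z.2] & (control_measure A < +oo)%E].

Context d (T : measurableType d) (P : probability T R).

(* The library's [normal_prob 0 0] is the uniform law on [0, 1], hence the
   separate treatment of the degenerate Gaussian law. *)
Definition centered_gaussian (X : T -> R) : Prop :=
  exists2 s : R, 0 <= s & forall U : set (measurableTypeR R), measurable U ->
    P (X @^-1` U) = if s == 0 then \d_(0 : R) U else normal_prob 0 s U.

Definition white_noise (W : set plane -> {RV P >-> measurableTypeR R}) : Prop :=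
  (forall (n : nat) (A : 'I_n -> set plane) (c : 'I_n -> R),
     (forall i, admissible (A i)) ->
     centered_gaussian (fun w => \sum_(i < n) c i * W (A i) w)) /\
  (forall A B : set plane, admissible A -> admissible B ->
     'E_P[fun w => (W A w * W B w)%R] = control_measure (A `&` B))%E.

End white_noise.

Section chaos.
Context {R : realType}.
Local Notation plane := (measurableTypeR R * measurableTypeR R)%type.

Definition cone (m : nat) (t : R) : set plane :=
  [set z | Num.max (2 * `|z.1 - t|) (2 ^- m) < z.2 /\ `|z.1 - t| < 1 / 2].

Context d (T : measurableType d) (P : probability T R).

Definition continuous_version
    (W : set plane -> {RV P >-> measurableTypeR R})
    (psi : nat -> R -> {RV P >-> measurableTypeR R}) : Prop :=
  (forall m (t : R), t \in `[0, 1] ->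
     {ae P, forall w, psi m t w = W (cone m t) w}) /\
  (forall m (w : T), {within `[0, 1], continuous (fun t : R => psi m t w : R)}).

Definition approx_chaos (psi : nat -> R -> {RV P >-> measurableTypeR R})
    (gamma : R) (m : nat) (w : T) (A : set (measurableTypeR R)) : \bar R :=
  (\int[lebesgue_measure]_(t in A `&` `[0%R, 1%R])
     (expR (gamma * psi m t w
            - gamma ^+ 2 / 2 * fine ('E_P[fun w' => ((psi m t w') ^+ 2)%R])%E))%:E)%E.

(* The limit is a measure on the line, carried by [0, 1] since every
   [approx_chaos psi gamma m w] is. *)
Definition is_gmc (psi : nat -> R -> {RV P >-> measurableTypeR R}) (gamma : R)
    (mu : R.-ker T ~> measurableTypeR R) : Prop :=
  {ae P, forall w, weakly_converges
                     (fun m => approx_chaos psi gamma m w) (mu w)}.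

End chaos.

(* Main.v *)
(* With q = min(2, sqrt 2 / gamma), the q-th moment of the mass of a dyadic
   interval of length 2^-n is O(2^-n r^n), where
   r = 2^-((q - 1) (1 - gamma^2 q / 2)), uniformly in the cut-off level m and in
   the mesh of the Riemann sums that approximate the mass. Summing over dyadic
   intervals and applying Fatou's lemma twice gives an almost sure bound
   O(2^(-n beta)) for every beta < D_gamma / 2, which weak convergence transfers
   to the limit.
   The moment bound avoids independence: S^q is S times S^(q-1), the power q - 1
   in (0, 1] is subadditive over the dyadic annuli |s - t| ~ 2^-j, and on each
   annulus it is replaced by the tangent of x^(q-1) at the random point
   c_j exp(gamma W(cone j t)), so that only expectations of exponentials of
   linear combinations of the noise remain. *)

(* Seen from t, the mass at distance about 2^-j is comparable to 2^-j times the level-j density at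
   t, because the two fields share essentially the noise above height 2^-j. A tangent of x^(q - 1)
   taken at that random value loses only a constant factor; when q < 2, a deterministic tangency
   point would lose a power of 2^j. The cap q <= 2 comes from this step: x^(q - 1) has to be
   subadditive and concave. No maximal inequality and no uniform integrability enters. Finite
   Riemann sums also keep every expectation within finite Gaussian families, and the continuous
   version has to agree with the noise on the countable dyadic grid only. *)
Require Import Defs.
From HB Require Import structures.
From mathcomp Require Import all_boot all_order all_algebra.
From mathcomp Require Import all_classical all_reals all_analysis.
From mathcomp Require Import measurable_realfun ring lra.
Import Order.TTheory GRing.Theory Num.Theory.
Import numFieldNormedType.Exports.
Local Open Scope classical_set_scope.
Local Open Scope ring_scope.
Set Implicit Arguments.
Unset Strict Implicit.
Unset Printing Implicit Defensive.

(** * Exponential moments of centered Gaussian variables *)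

Section gaussian.
Context {R : realType}.
Local Notation lebesgue := (@lebesgue_measure R).

(** The Radon-Nikodym derivative and [normal_pdf] have the same integral over every measurable set,
    so they agree almost everywhere, and the change of variables for the former carries over. *)
Lemma ge0_integral_normal_prob (m s : R) (f : measurableTypeR R -> \bar R) :
  measurable_fun setT f -> (forall x, 0 <= f x)%E ->
  (\int[normal_prob m s]_x f x =
   \int[lebesgue]_x (f x * (normal_pdf m s x)%:E))%E.
Proof.
move=> mf f0; have dom := normal_prob_dominates m s.
rewrite -(Radon_Nikodym_SigmaFinite.change_of_variables dom)//.
have mpdf : measurable_fun setT (fun x => (normal_pdf m s x)%:E).
  by apply/measurable_EFinP; exact: measurable_normal_pdf.
have mrn := measurable_int _ (Radon_Nikodym_SigmaFinite.f_integrable dom).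
apply: ae_eq_integral => //; try exact: emeasurable_funM.
apply: ae_eqe_mul2l; apply: integral_ae_eq => //.
  exact: Radon_Nikodym_SigmaFinite.f_integrable.
by move=> E _ mE; rewrite -Radon_Nikodym_SigmaFinite.f_integral.
Qed.

(** Completing the square: an exponential tilt of a Gaussian density shifts its mean. *)
Lemma expR_normal_pdf (c s x : R) : s != 0 ->
  expR (c * x) * normal_pdf 0 s x =
  expR (c ^+ 2 * s ^+ 2 / 2) * normal_pdf (c * s ^+ 2) s x.
Proof.
move=> s0; rewrite !normal_pdfE// /normal_fun !(mulrCA _ (normal_peak s)).
rewrite -!expRD; congr (_ * expR _).
by field.
Qed.

Lemma normal_mgf (c s : R) : s != 0 ->
  (\int[normal_prob 0 s]_x (expR (c * x))%:E =
   (expR (c ^+ 2 * s ^+ 2 / 2))%:E)%E.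
Proof.
move=> s0; rewrite ge0_integral_normal_prob; last 2 first.
- by apply/measurable_EFinP/measurableT_comp => //; exact: measurable_funM.
- by move=> x; rewrite lee_fin expR_ge0.
under eq_integral do rewrite -EFinM expR_normal_pdf// EFinM.
rewrite ge0_integralZl_EFin ?expR_ge0//.
- by rewrite integral_normal_pdf mule1.
- by move=> x _; rewrite lee_fin normal_pdf_ge0.
- by apply/measurable_EFinP; exact: measurable_normal_pdf.
Qed.

(** The density of deviation s / r is r exp(- k x^2) times that of deviation s, with k = (r^2 - 1) /
    (2 s^2), and exp(- u) >= 1 - u. Both densities have mass 1, so integrating compares s^2 with the
    second moment without computing that moment. *)
Lemma normal_pdf_scale_ge (s r x : R) : 0 < s -> 0 < r ->
  r * normal_pdf 0 s x <= normal_pdf 0 (s / r) x +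
    r * ((r ^+ 2 - 1) / (2 * s ^+ 2)) * (x ^+ 2 * normal_pdf 0 s x).
Proof.
move=> s0 r0; have sr0 : 0 < s / r by rewrite divr_gt0.
rewrite !normal_pdfE ?gt_eqF//.
have -> : normal_peak (s / r) = r * normal_peak s.
  rewrite /normal_peak (_ : (s / r) ^+ 2 * pi *+ 2 =
    (r^-1) ^+ 2 * (s ^+ 2 * pi *+ 2)).
    rewrite sqrtrM ?sqr_ge0// sqrtr_sqr gtr0_norm ?invr_gt0//.
    by rewrite invfM invrK.
  by rewrite exprMn -mulrnAr; ring.
have -> : normal_fun 0 (s / r) x =
    normal_fun 0 s x * expR (- ((r ^+ 2 - 1) / (2 * s ^+ 2) * x ^+ 2)).
  by rewrite /normal_fun -expRD; congr expR; field; rewrite !gt_eqF.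
set k := (r ^+ 2 - 1) / (2 * s ^+ 2).
have := expR_ge1Dx (- (k * x ^+ 2)).
have := normal_fun_ge0 0 s x; have := normal_peak_ge0 s.
move: (normal_fun _ _ _) (normal_peak s) (expR _) => f g e g0 f0 e1.
have := ler_wpM2l (mulr_ge0 (mulr_ge0 (ltW r0) g0) f0) e1.
by lra.
Qed.

(* Integrating the previous bound gives r <= 1 + r (r^2 - 1) / (2 s^2) E X^2
   for every r > 1; let r tend to 1. *)
Lemma normal_second_moment_ge (s v : R) : 0 < s ->
  (\int[normal_prob 0 s]_x (x ^+ 2)%:E <= v%:E)%E -> s ^+ 2 <= v.
Proof.
move=> s0.
have mx2 : measurable_fun setT (fun x : R => (x ^+ 2)%:E).
  by apply/measurable_EFinP; exact: measurable_funX.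
have mpdf r : measurable_fun setT (fun x : R => (normal_pdf 0 r x)%:E).
  by apply/measurable_EFinP; exact: measurable_normal_pdf.
rewrite ge0_integral_normal_prob//; last first.
  by move=> x; rewrite lee_fin sqr_ge0.
move=> hv.
have v0 : 0 <= v.
  rewrite -lee_fin; apply: le_trans hv; apply: integral_ge0 => x _.
  by rewrite -EFinM lee_fin mulr_ge0 ?sqr_ge0 ?normal_pdf_ge0.
have key r : 1 < r -> 2 * s ^+ 2 <= r * (r + 1) * v.
  move=> r1; have r0 : 0 < r by lra.
  set k := (r ^+ 2 - 1) / (2 * s ^+ 2).
  have k0 : 0 <= k.
    apply: divr_ge0; first by rewrite subr_ge0 exprn_ege1// ltW.
    by rewrite mulr_ge0 ?sqr_ge0.
  have : (r%:E <= 1 + (r * k)%:E * v%:E)%E.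
    rewrite -[leLHS]mule1 -(integral_normal_pdf 0 s).
    rewrite -ge0_integralZl_EFin ?(ltW r0)//; last first.
    - exact: mpdf.
    - by move=> x _; rewrite lee_fin normal_pdf_ge0.
    apply: (@le_trans _ _ (\int[lebesgue]_x ((normal_pdf 0 (s / r) x)%:E +
        (r * k)%:E * ((x ^+ 2)%:E * (normal_pdf 0 s x)%:E)))%E).
      apply: ge0_le_integral => //.
      - by move=> x _; rewrite -EFinM lee_fin mulr_ge0 ?normal_pdf_ge0// ltW.
      - apply: emeasurable_funM => //; exact: mpdf.
      - apply: emeasurable_funD; first exact: mpdf.
        apply: emeasurable_funM => //; apply: emeasurable_funM => //.
        exact: mpdf.
      - move=> x _; rewrite -!EFinM -EFinD lee_fin.
        exact: normal_pdf_scale_ge.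
    rewrite ge0_integralD//; last 4 first.
    - by move=> x _; rewrite lee_fin normal_pdf_ge0.
    - exact: mpdf.
    - move=> x _; rewrite -!EFinM lee_fin mulr_ge0 ?(mulr_ge0 (ltW r0))//.
      by rewrite mulr_ge0 ?sqr_ge0 ?normal_pdf_ge0.
    - apply: emeasurable_funM => //; apply: emeasurable_funM => //.
      exact: mpdf.
    rewrite !integral_normal_pdf leeD2l//.
    have rk0 : 0 <= r * k by rewrite (mulr_ge0 (ltW r0)).
    rewrite ge0_integralZl_EFin//; last 2 first.
    - by move=> x _; rewrite -EFinM lee_fin mulr_ge0 ?normal_pdf_ge0 ?sqr_ge0.
    - by apply: emeasurable_funM => //; exact: mpdf.
    by rewrite lee_wpmul2l.
  rewrite -EFinM -EFinD lee_fin => h.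
  have s2 : 0 < s ^+ 2 by rewrite exprn_gt0.
  have : (r - 1) * (2 * s ^+ 2) <= (r - 1) * (r * (r + 1) * v).
    have -> : (r - 1) * (r * (r + 1) * v) = r * k * v * (2 * s ^+ 2).
      by rewrite /k; field; rewrite gt_eqF.
    by rewrite ler_wpM2r//; [lra|lra].
  by rewrite ler_pM2l// subr_gt0.
(* With r = 1 + t and t <= 1, [key] gives s^2 <= v + 2 t v, and t is chosen so that t (3 v + 1) <=
   e. The added 1 keeps the denominator positive when v = 0. *)
apply/ler_addgt0Pr => e e0.
have [d0 hd] : 0 < Num.min 1 (e / (3 * v + 1)) /\
    Num.min 1 (e / (3 * v + 1)) * (3 * v + 1) <= e.
  split; first by rewrite lt_min ltr01 divr_gt0//; lra.
  by rewrite -ler_pdivlMr ?ge_min ?lexx ?orbT//; lra.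
have d1 : Num.min 1 (e / (3 * v + 1)) <= 1 by rewrite ge_min lexx.
move: (Num.min _ _) d0 hd d1 => t t0 ht t1.
have := key (1 + t); rewrite ltrDl => /(_ t0).
have : t * t * v <= t * v by rewrite -mulrA ler_piMl// mulr_ge0// ltW.
move: (s ^+ 2) => S; nra.
Qed.

Context d (T : measurableType d) (P : probability T R).

(** The exponential moment exp(s^2 / 2) increases with s^2, so the one-sided bound s^2 <= v
    suffices. When s = 0 the law is a Dirac mass, X vanishes almost everywhere and v >= 0 is
    enough. *)
Lemma centered_gaussian_expR_le (X : T -> measurableTypeR R) (v : R) :
  measurable_fun setT X ->
  centered_gaussian P X -> ('E_P[fun w => (X w ^+ 2)%R] <= v%:E)%E ->
  (\int[P]_w (expR (X w))%:E <= (expR (v / 2))%:E)%E.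
Proof.
move=> mX [s s0 lawX]; rewrite unlock => hv.
pose Y : {RV P >-> measurableTypeR R} := mfun_Sub (mem_set mX).
have [s00|sN0] := eqVneq s 0.
  have X0 : {ae P, forall w, X w = 0}.
    exists (X @^-1` (~` [set 0])); split => //.
    - by rewrite -[X @^-1` _]setTI; apply: (mX) => //; exact: measurableC.
    - rewrite lawX; last exact: measurableC.
      by rewrite s00 eqxx diracE memNset//= => /(_ erefl).
  have v0 : 0 <= v.
    rewrite -lee_fin; apply: le_trans hv; apply: integral_ge0 => x _.
    by rewrite lee_fin sqr_ge0.
  apply: (@le_trans _ _ (\int[P]_w 1)%E); last first.
    have -> : (\int[P]_w 1 = 1)%E.
      by rewrite integral_cst// mul1e; exact: probability_setT.
    rewrite lee_fin -expR0 ler_expR.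
    by rewrite divr_ge0.
  apply: ae_ge0_le_integral => //.
  - by apply/measurable_EFinP; apply: measurableT_comp.
  - by apply: filterS X0 => w -> _; rewrite expR0.
have law U : measurable U -> distribution P Y U = normal_prob 0 s U.
  by move=> mU; rewrite /distribution/= /pushforward lawX// (negbTE sN0).
have E f : measurable_fun setT f -> (forall x, 0 <= f x)%E ->
    (\int[P]_w f (X w) = \int[normal_prob 0 s]_x f x)%E.
  move=> mf f0; rewrite -(ge0_integral_distribution Y mf f0).
  by apply: eq_measure_integral => A mA _; exact: law.
rewrite (E (fun x => (expR x)%:E)); last 2 first.
- by apply/measurable_EFinP; exact: measurable_expR.
- by move=> x; rewrite lee_fin expR_ge0.
have := normal_mgf 1 sN0; under eq_integral do rewrite mul1r.
move=> ->; rewrite lee_fin ler_expR expr1n mul1r ler_pM2r//.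
have sp : 0 < s by rewrite lt_neqAle eq_sym sN0.
apply: (normal_second_moment_ge sp); rewrite -E//.
- by apply/measurable_EFinP; exact: measurable_funX.
- by move=> x; rewrite lee_fin sqr_ge0.
Qed.

End gaussian.

(** * Exponential moments of linear combinations of the noise *)

Section white_noise_mgf.
Context {R : realType} d (T : measurableType d) (P : probability T R).
Variable W : set (measurableTypeR R * measurableTypeR R) ->
  {RV P >-> measurableTypeR R}.
Hypothesis noiseW : white_noise W.

Let mW A : measurable_fun setT (fun w => W A w : R).
Proof. exact: (@measurable_funPT _ _ _ _ (W A)). Qed.

Lemma white_noise_integrable_sqr A : admissible A ->
  P.-integrable setT (fun w => (W A w ^+ 2)%:E).
Proof.
move=> admA; have [_ cov] := noiseW; have [_ _ fin] := admA.
apply/integrableP; split.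
  by apply/measurable_EFinP/measurable_funX; exact: mW.
under eq_integral do rewrite gee0_abs ?lee_fin ?sqr_ge0//.
by have := cov A A admA admA; rewrite unlock setIid => ->.
Qed.

Lemma white_noise_integrable_mul A B : admissible A -> admissible B ->
  P.-integrable setT (fun w => (W A w * W B w)%:E).
Proof.
move=> admA admB.
have iA := white_noise_integrable_sqr admA.
have iB := white_noise_integrable_sqr admB.
apply: (le_integrable measurableT _ _ (integrableD measurableT iA iB)).
  by apply/measurable_EFinP/measurable_funM; exact: mW.
move=> w _; rewrite lee_fin /= [leRHS]ger0_norm ?addr_ge0 ?sqr_ge0//.
by rewrite ler_norml; nra.
Qed.

Lemma white_noise_covariance_fin
    (A B : set (measurableTypeR R * measurableTypeR R)) :
  admissible A -> admissible B ->
  control_measure (A `&` B) = (fine (control_measure (A `&` B)))%:E.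
Proof.
move=> admA admB; have [_ cov] := noiseW; rewrite -cov// fineK//.
rewrite unlock; apply: integrable_fin_num => //.
exact: white_noise_integrable_mul.
Qed.

(** The double sum is the variance of the linear combination, expanded by bilinearity. *)
Lemma white_noise_expR_le n
    (A : 'I_n -> set (measurableTypeR R * measurableTypeR R)) (c : 'I_n -> R) :
  (forall i, admissible (A i)) ->
  (\int[P]_w (expR (\sum_(i < n) c i * W (A i) w)%R)%:E <=
   (expR ((\sum_(i < n) \sum_(j < n)
     c i * c j * fine (control_measure (A i `&` A j))) / 2)%R)%:E)%E.
Proof.
move=> admA; have [gaussW cov] := noiseW.
have mX : measurable_fun setT (fun w => \sum_(i < n) c i * W (A i) w).
  by apply: measurable_sum => i; exact: measurable_funM.
apply: (centered_gaussian_expR_le mX); first exact: gaussW.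
rewrite unlock /=.
have sqrE w : ((\sum_(i < n) c i * W (A i) w) ^+ 2)%:E =
    (\sum_(i < n) \sum_(j < n)
      (c i * c j)%:E * (W (A i) w * W (A j) w)%:E)%E.
  rewrite expr2 mulr_suml -sumEFin; apply: eq_bigr => i _.
  rewrite mulr_sumr -sumEFin; apply: eq_bigr => j _.
  by rewrite -EFinM; congr EFin; ring.
under eq_integral do rewrite sqrE.
have iM i j : P.-integrable setT
    (fun w => (c i * c j)%:E * (W (A i) w * W (A j) w)%:E)%E.
  by apply: integrableZl => //; exact: white_noise_integrable_mul.
rewrite integral_sum//; last by move=> i; exact: integrable_sum.
rewrite -sumEFin; apply: lee_sum => i _.
rewrite integral_sum// -sumEFin; apply: lee_sum => j _.
rewrite integralZl//; last exact: white_noise_integrable_mul.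
rewrite [leRHS]EFinM -(white_noise_covariance_fin (admA i) (admA j)) -cov//.
by rewrite unlock.
Qed.

End white_noise_mgf.

(** * Control measure of cones and of their intersections *)

Section cone_measure.
Context {R : realType}.
Local Notation plane := (measurableTypeR R * measurableTypeR R)%type.

Lemma measurable_cone m (t : R) : measurable (cone m t : set plane).
Proof.
have -> : cone m t =
    (fun z : plane => z.2 - Num.max (2 * `|z.1 - t|) (2 ^- m)) @^-1` `]0, +oo[
    `&` (fun z : plane => `|z.1 - t|) @^-1` `]-oo, 1 / 2[.
  by apply/seteqP; split => z /=; rewrite !in_itv/= subr_gt0 andbT.
have mB : measurable_fun setT (fun z : plane => `|z.1 - t|).
  apply: measurableT_comp => //; exact: measurable_funB.
apply: measurableI; rewrite -[X in measurable X]setTI.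
- apply: (measurable_funB _ _) => //.
  by apply: measurable_maxr => //; exact: measurable_funM.
- exact: mB.
Qed.

Lemma measurable_invX2 (D : set (measurableTypeR R)) :
  measurable D -> D `<=` [set y | 0 < y] ->
  measurable_fun D (fun y : R => y ^- 2).
Proof.
move=> mD D0; apply: (eq_measurable_fun (fun y : R => y `^ (- 2%:R))).
  by move=> y /[!inE] /D0 /= y0; rewrite powRN powR_mulrn// ltW.
by apply: measurable_funTS; exact: measurable_powR.
Qed.

(** One antiderivative for both pieces of [integral_width]: a = 1, b = del below height 1, and a =
    0, b = del - 1 above it. *)
Lemma is_derive_ln_inv (a b y : R) : 0 < y ->
  is_derive y 1 (fun y => a * ln y + b * y^-1) (a * y^-1 - b * y ^- 2).
Proof.
move=> y0; have y_neq0 : y != 0 by rewrite gt_eqF.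
have dln := is_derive1_ln y0.
have dinv := is_deriveV y_neq0 (is_derive_id y 1).
apply: is_derive_eq; rewrite /GRing.scale /=; lra.
Qed.

(** At height y, two cones with apexes at distance del overlap in an interval of length min(y, 1) -
    del, so this is the control measure of their overlap above height e. The integral is split at y
    = 1, where the cones stop widening. *)
Lemma integral_width (e del : R) : 0 < e <= 1 -> 0 <= del <= e ->
  (\int[lebesgue_measure]_(y in `]e, +oo[)
     (y ^- 2 * (Num.min y 1 - del))%:E = (1 - ln e - del / e)%:E)%E.
Proof.
move=> /andP[e0 e1] /andP[del0 dele].
have dF2 (y : R) : 0 < y -> is_derive y 1 (fun y => - ((1 - del) * y^-1))
    ((1 - del) * y ^- 2).
  move=> y0; have := is_derive_ln_inv 0 (- (1 - del)) y0.
  rewrite mul0r sub0r mulNr opprK; congr (is_derive _ _ _ _).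
  by apply/funext => z; rewrite mul0r add0r mulNr.
have del1 : del <= 1 by exact: le_trans e1.
have mf (D : set (measurableTypeR R)) :
    measurable D -> D `<=` [set y | 0 < y] ->
    measurable_fun D (fun y : R => (y ^- 2 * (Num.min y 1 - del))%:E).
  move=> mD D0; apply/measurable_EFinP/measurable_funM.
    exact: measurable_invX2.
  apply: measurable_funTS; apply: measurable_funB => //.
  exact: measurable_minr.
have -> : `]e, +oo[%classic = `]e, 1] `|` `]1, +oo[ :> set R.
  by rewrite -itv_bndbnd_setU// bnd_simp.
rewrite ge0_integral_setU//=; last 3 first.
- apply: mf; first exact: measurableU.
  by move=> y [] /=; rewrite in_itv/= ?andbT => yi; lra.
- move=> y; rewrite /= !in_itv/= andbT => y1; rewrite lee_fin mulr_ge0//.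
    by rewrite invr_ge0 sqr_ge0.
  rewrite subr_ge0 le_min del1 andbT.
  by case: y1 => y1; lra.
- rewrite disj_set2E; apply/eqP; rewrite -subset0 => y [] /=.
  by rewrite !in_itv/= andbT => /andP[_ y1]; rewrite ltNge y1.
have -> : (\int[lebesgue_measure]_(y in `]1%R, +oo[)
    (y ^- 2 * (Num.min y 1 - del))%:E = (1 - del)%:E)%E.
  rewrite integral_itv_obnd_cbnd; last first.
    by apply: mf => // y /=; rewrite in_itv/=; lra.
  under eq_integral.
    move=> y; rewrite inE/= in_itv/= andbT => y1; rewrite min_r//; over.
  rewrite (@ge0_continuous_FTC2y _ _ (fun y => - ((1 - del) * y^-1)) 1 0).
  - by rewrite invr1 mulr1 -EFinN opprK add0e.
  - by move=> y y1; rewrite mulr_ge0 ?invr_ge0 ?sqr_ge0// subr_ge0.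
  - apply: continuous_in_subspaceT => y /[!inE] /=.
    rewrite in_itv/= andbT => y1.
    apply: cvgM; last exact: cvg_cst.
    apply: cvgV; first by rewrite expf_neq0// gt_eqF//; lra.
    exact: exprn_continuous.
  - rewrite -[0](mulr0 (-(1 - del))).
    under eq_fun do rewrite -mulNr.
    apply: cvgM; first exact: cvg_cst.
    by apply/gtr0_cvgV0; [exact: nbhs_pinfty_gt|exact: cvg_id].
  - by move=> y y1; have [+ _] := dF2 y (lt_trans ltr01 y1).
  - apply: cvg_at_right_filter.
    have [/derivable1_diffP/differentiable_continuous + _] := dF2 1 ltr01.
    exact.
  - move=> y; rewrite in_itv/= andbT => y1.
    have [_ +] := dF2 y (lt_trans ltr01 y1).
    by rewrite derive1E => ->; rewrite mulrC.
have [->|en1] := eqVneq e 1.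
  rewrite set_itv_ge ?bnd_simp// integral_set0 add0e ln1.
  by rewrite invr1 mulr1 subr0.
rewrite integral_itv_obnd_cbnd; last first.
    by apply: mf => // y /=; rewrite in_itv/=; lra.
under eq_integral.
  move=> y; rewrite inE/= in_itv/= => /andP[_ y1]; rewrite min_l//; over.
have e_lt1 : e < 1 by rewrite lt_neqAle en1.
rewrite (@continuous_FTC2 _ _ (fun y => ln y + del * y^-1))//.
- by rewrite ln1 invr1 -EFinB -EFinD; congr EFin; lra.
- apply: continuous_in_subspaceT => y /[!inE] /=.
  rewrite in_itv/= => /andP[ey _].
  apply: cvgM; last by apply: cvgB; [exact: cvg_id|exact: cvg_cst].
  apply: cvgV; first by rewrite expf_neq0// gt_eqF//; lra.
  exact: exprn_continuous.
- have dF1 y : 0 < y -> derivable (fun y => ln y + del * y^-1 : R^o) y 1.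
    move=> y0; have [+ _] := is_derive_ln_inv 1 del y0.
    by under eq_fun do rewrite mul1r.
  have cF1 y : 0 < y -> {for y, continuous (fun y => ln y + del * y^-1)}.
    by move=> /dF1 /derivable1_diffP; exact: differentiable_continuous.
  split.
  + by move=> y; rewrite in_itv/= => /andP[ey _]; apply: dF1; lra.
  + by apply: cvg_at_right_filter; exact: cF1.
  + by apply: cvg_at_left_filter; exact: cF1.
- move=> y; rewrite in_itv/= => /andP[ey _]; have y0 : 0 < y by lra.
  rewrite derive1E; have [_ +] := is_derive_ln_inv 1 del y0.
  under eq_fun do rewrite mul1r.
  by move=> ->; field; rewrite gt_eqF.
Qed.

(** The control measure of [cone m t], hence the variance of [W (cone m t)]: the part above height 1
    contributes 1, each dyadic layer below it ln 2. *)
Definition cone_mass (m : nat) : R := 1 + m%:R * ln 2.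

Lemma cone_upper m (t : R) : (cone m t : set plane) `<=` [set z | 0 < z.2].
Proof.
move=> z [+ _]; rewrite /= gt_max => /andP[+ _]; apply: le_lt_trans.
by rewrite mulr_ge0.
Qed.

Lemma measurable_control_density (A : set plane) :
  measurable A -> A `<=` [set z | 0 < z.2] ->
  measurable_fun A (fun z => (z.2 ^- 2)%:E).
Proof.
move=> mA A0; apply/measurable_EFinP.
pose U : set (measurableTypeR R) := `]0, +oo[%classic.
have mU : measurable U by exact: measurable_itv.
apply: (measurable_comp mU _ (measurable_invX2 mU _)).
- by move=> _ [z /A0 /= z0 <-]; rewrite /U /= in_itv/= andbT.
- by move=> y; rewrite /U /= in_itv/= andbT.
- exact: measurable_funTS.
Qed.

Lemma le_control_measure (A B : set plane) :
  measurable A -> measurable B -> A `<=` B -> B `<=` [set z | 0 < z.2] ->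
  (control_measure A <= control_measure B)%E.
Proof.
move=> mA mB AB B0; apply: ge0_subset_integral => //.
  exact: measurable_control_density.
by move=> z _; rewrite lee_fin invr_ge0 sqr_ge0.
Qed.

(** Tonelli with the height as outer variable reduces to [integral_width]. The bound on the distance
    gives every slice above the cut-off a nonnegative width, so no truncation at 0 appears. *)
Lemma control_measure_coneI m (s t : R) : `|s - t| <= 2 ^- m ->
  control_measure (cone m s `&` cone m t : set plane) =
  (cone_mass m - `|s - t| * 2 ^+ m)%:E.
Proof.
wlog st : s t / s <= t => [wlg|].
  have [/wlg //|/ltW ts] := leP s t.
  by rewrite setIC distrC; exact: wlg.
rewrite distrC ger0_norm ?subr_ge0// => st2.
set A : set plane := _ `&` _.
have mA : measurable A by apply: measurableI; exact: measurable_cone.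
have A0 : A `<=` [set z | 0 < z.2] by move=> z [/cone_upper].
have e0 : 0 < 2 ^- m :> R by rewrite invr_gt0 exprn_gt0.
have e1 : 2 ^- m <= 1 :> R.
  by rewrite invf_le1 ?exprn_gt0// exprn_ege1// ler1n.
have -> : cone_mass m - (t - s) * 2 ^+ m =
    1 - ln (2 ^- m) - (t - s) / 2 ^- m.
  by rewrite /cone_mass lnV ?posrE ?exprn_gt0// lnXn// invrK opprK mulr_natl.
rewrite -integral_width ?e0//; last by rewrite subr_ge0 st.
rewrite /control_measure integral_mkcond fubini_tonelli2; last 2 first.
- apply/(measurable_restrictT _ mA).
  exact: measurable_control_density.
- move=> z; rewrite patchE; case: ifP => // _.
  by rewrite lee_fin invr_ge0 sqr_ge0.
rewrite [RHS]integral_mkcond; apply: eq_integral => y _.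
rewrite /fubini_G patchE; case: ifPn => [|].
  rewrite inE/= in_itv/= andbT => y_gt.
  have y0 : 0 < y by exact: lt_trans y_gt.
  transitivity (\int[lebesgue_measure]_x ((y ^- 2)%:E *
      (\1_(`]t - Num.min y 1 / 2, s + Num.min y 1 / 2[) x)%:E))%E.
    apply: eq_integral => x _; rewrite patchE indicE.
    have -> : ((x, y) \in A) =
        (x \in `]t - Num.min y 1 / 2, s + Num.min y 1 / 2[%classic).
      apply/idP/idP; rewrite !inE /A /cone /= in_itv/= !gt_max y_gt !andbT.
      - move=> [[ys]]; rewrite ltr_norml => /andP[xs1 xs2] [yt].
        rewrite ltr_norml => /andP[xt1 xt2].
        have := ler_norm (x - s); have := ler_norm (t - x).
        by rewrite (distrC t); have [y1|y1] := leP y 1; lra.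
      - move=> xst.
        have {}xst : [/\ `|x - s| < y / 2, `|x - s| < 1 / 2,
            `|x - t| < y / 2 & `|x - t| < 1 / 2].
          by move: xst; rewrite !ltr_norml; have [y1|y1] := leP y 1; split; lra.
        by case: xst; split; split; lra.
    by case: ifP => _; rewrite ?mule1 ?mule0.
  rewrite ge0_integralZl_EFin//; last 2 first.
  - exact/measurable_EFinP/measurable_indic.
  - by rewrite invr_ge0 sqr_ge0.
  rewrite integral_indic// setIT EFinM; congr (_ * _)%E.
  apply: (etrans (lebesgue_measure_itv _)).
  rewrite /= lte_fin; case: ltP => [_|].
    by rewrite -EFinB; congr EFin; lra.
  by move=> h; congr EFin; move: h; have [y1|y1] := leP y 1; lra.
rewrite notin_setE/= in_itv/= andbT => /negP; rewrite -leNgt => y_le.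
rewrite integral0_eq// => x _; rewrite patchE memNset// => -[[/=]].
by rewrite gt_max => /andP[_]; rewrite ltNge y_le.
Qed.

Lemma control_measure_cone m (t : R) :
  control_measure (cone m t : set plane) = (cone_mass m)%:E.
Proof.
have := @control_measure_coneI m t t; rewrite subrr normr0 mul0r subr0 setIid.
by apply; rewrite invr_ge0 exprn_ge0.
Qed.

Lemma admissible_cone m (t : R) : admissible (cone m t : set plane).
Proof.
split; [exact: measurable_cone|exact: cone_upper|].
by rewrite control_measure_cone ltry.
Qed.

Lemma subset_cone j m (t : R) : (j <= m)%N ->
  (cone j t : set plane) `<=` cone m t.
Proof.
move=> jm z [h1 h2]; split=> //; apply: le_lt_trans h1.
rewrite ge_max !le_max lexx/= orbC lef_pV2 ?posrE ?exprn_gt0//.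
by rewrite ler_weXn2l// ler1n.
Qed.

(** A common point lies at height y > 2 |x - s| and y > 2 |x - t|, hence y > |s - t| >= 2^-(j+1) by
    the triangle inequality, so it belongs to [cone j.+1 t]. When j = m the cut-off itself gives the
    height. *)
Lemma control_measure_coneI_le j m (s t : R) : (j <= m)%N ->
  (j == m) || (2 ^- j.+1 <= `|s - t|) ->
  (control_measure (cone m s `&` cone m t : set plane) <=
   (cone_mass j.+1)%:E)%E.
Proof.
move=> jm hj; rewrite -(control_measure_cone _ t); apply: le_control_measure.
- by apply: measurableI; exact: measurable_cone.
- exact: measurable_cone.
- move=> z [[+ _] [+ zt]]; rewrite !gt_max => /andP[zs1 zm] /andP[zt1 _].
  split=> //; rewrite gt_max zt1/=.
  case/orP: hj => [/eqP jE|hj].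
    apply: le_lt_trans zm; rewrite -jE lef_pV2 ?posrE ?exprn_gt0//.
    by rewrite ler_weXn2l// ler1n.
  apply: (le_lt_trans hj); apply: (@le_lt_trans _ _ (`|z.1 - s| + `|z.1 - t|)).
    by rewrite (distrC z.1 s) (le_trans _ (ler_normD _ _))// addrA subrK.
  lra.
- exact: cone_upper.
Qed.

(** Already the level-j cones share all but |s - t| 2^j <= 1 of their mass. *)
Lemma control_measure_coneI_ge j m (s t : R) : (j <= m)%N ->
  `|s - t| <= 2 ^- j ->
  ((cone_mass j - 1)%:E <=
   control_measure (cone m s `&` cone j t : set plane))%E.
Proof.
move=> jm st; apply: (@le_trans _ _
  (control_measure (cone j s `&` cone j t : set plane))).
  rewrite control_measure_coneI// lee_fin lerD2l lerN2.
  by rewrite -ler_pdivlMr ?exprn_gt0// mul1r.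
apply: le_control_measure.
- by apply: measurableI; exact: measurable_cone.
- by apply: measurableI; exact: measurable_cone.
- by apply: setSI; exact: subset_cone.
- by move=> z [_ /cone_upper].
Qed.

End cone_measure.

(** * Inequalities for powers of sums, and a counting bound *)

Section real_lemmas.
Context {R : realType}.
Implicit Types (p x y b : R).

Lemma ler_sum_seq (I : eqType) (r : seq I) (F G : I -> R) :
  (forall i, i \in r -> F i <= G i) ->
  \sum_(i <- r) F i <= \sum_(i <- r) G i.
Proof. by move=> FG; rewrite !big_seq; apply: ler_sum. Qed.

(* The right-hand side is the tangent of x^p at x = exp b. *)
Lemma powR_tangent p x b : 0 < p <= 1 -> 0 <= x ->
  x `^ p <= (1 - p) * expR (p * b) + p * expR ((p - 1) * b) * x.
Proof.
move=> /andP[p0 p1]; rewrite le_eqVlt => /predU1P[<-|x0].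
  by rewrite powR0 ?gt_eqF// mulr0 addr0 mulr_ge0 ?expR_ge0// subr_ge0.
rewrite {1}/powR gt_eqF//; set y := ln x.
have -> : x = expR y by rewrite lnK.
rewrite -mulrA -expRD.
have -> : (p - 1) * b + y = p * y + (1 - p) * (y - b) by ring.
have -> : p * b = p * y + - p * (y - b) by ring.
rewrite !expRD !(mulrCA _ (expR (p * y))) -mulrDr ler_peMr ?expR_ge0//.
(* The two bounds exp(u) >= 1 + u, weighted by 1 - p and p, have linear terms that cancel and
   constants that add up to 1. *)
have uz := expR_ge1Dx (- p * (y - b)).
have vz := expR_ge1Dx ((1 - p) * (y - b)).
have p1' : 0 <= 1 - p by rewrite subr_ge0.
have := ler_wpM2l (ltW p0) vz; have := ler_wpM2l p1' uz; lra.
Qed.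

(** On [0, 1] one has u <= u^p; this is applied to the shares x / (x + y) and y / (x + y), which add
    up to 1. *)
Lemma powR_subadditive p x y : 0 < p <= 1 -> 0 <= x -> 0 <= y ->
  (x + y) `^ p <= x `^ p + y `^ p.
Proof.
move=> /andP[p0 p1] x0 y0.
have [s0|s0] := eqVneq (x + y) 0.
  by rewrite s0 powR0 ?gt_eqF// addr_ge0 ?powR_ge0.
have s_gt0 : 0 < x + y by rewrite lt_neqAle eq_sym s0 addr_ge0.
have part z : 0 <= z -> z <= x + y -> z / (x + y) * (x + y) `^ p <= z `^ p.
  rewrite le_eqVlt => /predU1P[<-|z0] zs; first by rewrite !mul0r powR_ge0.
  have u0 : 0 < z / (x + y) by rewrite divr_gt0.
  have {2}-> : z = z / (x + y) * (x + y) by rewrite divfK.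
  rewrite powRM ?(ltW u0) ?(ltW s_gt0)// ler_wpM2r ?powR_ge0//.
  rewrite -[leLHS]powRr1 ?(ltW u0)//.
  by rewrite ger_powR// u0/= ler_pdivrMr// mul1r.
apply: le_trans (lerD (part x x0 _) (part y y0 _)); last 2 first.
- by rewrite lerDl.
- by rewrite lerDr.
by rewrite -mulrDl -mulrDl divff// mul1r.
Qed.

Lemma powR_sum_le p (I : Type) (s : seq I) (P : pred I) (F : I -> R) :
  0 < p <= 1 -> (forall i, P i -> 0 <= F i) ->
  (\sum_(i <- s | P i) F i) `^ p <= \sum_(i <- s | P i) F i `^ p.
Proof.
move=> p01 F0; elim: s => [|i s IH].
  by rewrite !big_nil powR0// gt_eqF//; case/andP: p01.
rewrite !big_cons; case: ifPn => // Pi.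
apply: le_trans (powR_subadditive p01 (F0 _ Pi) (sumr_ge0 _ F0)) _.
by rewrite lerD2l.
Qed.

(** Here [rel j i] stands for the annulus of scale j around i. The annuli only have to cover, so
    they may overlap at their boundaries. The tangency point exp(b j i) depends on the center i but
    not on i', so each term involves at most three exponentials. *)
Lemma powR_sum_tangent p (I J : eqType) (r : seq I) (s : seq J)
    (rel : J -> I -> I -> bool) (a : I -> R) (b : J -> I -> R) :
  0 < p <= 1 -> (forall i, 0 <= a i) ->
  (forall i i', i \in r -> i' \in r -> exists2 j, j \in s & rel j i i') ->
  (\sum_(i <- r) a i) `^ (1 + p) <=
  \sum_(i <- r) \sum_(j <- s)
    ((1 - p) * (a i * expR (p * b j i)) +
     p * \sum_(i' <- r | rel j i i') a i * a i' * expR ((p - 1) * b j i)).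
Proof.
move=> p01 a0 cover; have /andP[p0 p1] := p01.
set S := \sum_(i <- r) a i; have S0 : 0 <= S by exact: sumr_ge0.
have -> : S `^ (1 + p) = S * S `^ p.
  by rewrite powRD ?powRr1// gt_eqF// addr_gt0.
rewrite {1}/S mulr_suml; apply: ler_sum_seq => i ri.
have SleS : S <= \sum_(j <- s) \sum_(i' <- r | rel j i i') a i'.
  rewrite (exchange_big_dep xpredT)//=; apply: ler_sum_seq => i' ri'.
  have [j sj relj] := cover i i' ri ri'.
  by rewrite (big_rem j)//= relj lerDl sumr_ge0.
have sum0 j : 0 <= \sum_(i' <- r | rel j i i') a i' by exact: sumr_ge0.
apply: (@le_trans _ _ (a i * \sum_(j <- s)
    (\sum_(i' <- r | rel j i i') a i') `^ p)).
  rewrite ler_wpM2l//; apply: le_trans (powR_sum_le _ p01 _) => //.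
  apply: ge0_ler_powR; rewrite ?nnegrE ?(ltW p0)//.
  by apply: sumr_ge0 => j _.
rewrite mulr_sumr; apply: ler_sum => j _.
apply: le_trans (ler_wpM2l (a0 i) (powR_tangent (b j i) p01 (sum0 j))) _.
rewrite le_eqVlt; apply/orP; left; apply/eqP.
rewrite mulrDr; congr (_ + _); first by ring.
rewrite !mulr_sumr; apply: eq_bigr => i' _; ring.
Qed.

Lemma count_near_le (a b : nat) (x D : R) : 0 <= D ->
  \sum_(a <= i < b | `|i%:R - x| <= D) 1 <= 2 * D + 1 :> R.
Proof.
move=> D0; have [ba|] := leqP b a.
  by rewrite big_geq//; lra.
move=> /ltnW /subnKC <-; move: (b - a)%N => k {b}.
(* The induction also carries a bound by the distance from x - D to the right end of the range; when
   a new integer is counted, that distance is at most 2 D. *)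
have [cap1 cap2] : \sum_(a <= i < a + k | `|i%:R - x| <= D) 1
      <= Num.max 0 ((a + k)%:R - x + D) /\
    \sum_(a <= i < a + k | `|i%:R - x| <= D) 1 <= 2 * D + 1 :> R.
  elim: k => [|k [IH1 IH2]].
    by rewrite addn0 big_geq// le_max lexx; split => //; lra.
  rewrite addnS big_mkcond big_nat_recr ?leq_addr//= -big_mkcond/=.
  rewrite -[(a + k).+1%:R]natr1.
  case: ifPn => [|_].
    rewrite ler_norml => /andP[h1 h2]; split; last first.
      apply: (@le_trans _ _ (Num.max 0 ((a + k)%:R - x + D) + 1)).
        by rewrite lerD2r.
      by rewrite max_r; lra.
    apply: (@le_trans _ _ (Num.max 0 ((a + k)%:R - x + D) + 1)).
      by rewrite lerD2r.
    by rewrite max_r ?le_max; [apply/orP; right; lra|lra].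
  rewrite addr0; split => //; apply: (le_trans IH1).
  by rewrite ge_max !le_max lexx/=; apply/orP; right; lra.
by [].
Qed.
End real_lemmas.

(** * Bounds on expectations of nonnegative variables *)

Section mean_le.
Context {R : realType} d (T : measurableType d) (P : probability T R).

Implicit Types (f g : T -> R) (b c k : R).

(** Measurability and nonnegativity are bundled with the bound so that it passes through finite sums
    and dominations without separate side conditions. *)
Definition mean_le (f : T -> R) (b : R) : Prop :=
  [/\ measurable_fun setT f, forall w, 0 <= f w &
      (\int[P]_w (f w)%:E <= b%:E)%E].

Lemma mean_leD f g b c : mean_le f b -> mean_le g c ->
  mean_le (fun w => f w + g w) (b + c).
Proof.
move=> [mf f0 fb] [mg g0 gc]; split.
- exact: measurable_funD.
- by move=> w; rewrite addr_ge0.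
- under eq_integral do rewrite EFinD.
  rewrite ge0_integralD//; last 4 first.
  + by move=> w _; rewrite lee_fin.
  + exact/measurable_EFinP.
  + by move=> w _; rewrite lee_fin.
  + exact/measurable_EFinP.
  by rewrite EFinD leeD.
Qed.

Lemma mean_leZ k f b : 0 <= k -> mean_le f b ->
  mean_le (fun w => k * f w) (k * b).
Proof.
move=> k0 [mf f0 fb]; split.
- exact: measurable_funM.
- by move=> w; rewrite mulr_ge0.
- under eq_integral do rewrite EFinM.
  rewrite ge0_integralZl_EFin//; last 2 first.
  + by move=> w _; rewrite lee_fin.
  + exact/measurable_EFinP.
  by rewrite EFinM lee_wpmul2l.
Qed.

Lemma mean_le_sum (I : eqType) (s : seq I) (Q : pred I) (f : I -> T -> R)
    (b : I -> R) :
  (forall i, i \in s -> Q i -> mean_le (f i) (b i)) ->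
  mean_le (fun w => \sum_(i <- s | Q i) f i w) (\sum_(i <- s | Q i) b i).
Proof.
elim: s => [_|i s IH fb].
  have -> : (fun w : T => \sum_(i <- [::] | Q i) f i w) = cst 0.
    by apply/funext => w; rewrite big_nil.
  rewrite big_nil; split => //.
  by rewrite integral0_eq.
have {}IH : mean_le (fun w => \sum_(i <- s | Q i) f i w)
    (\sum_(i <- s | Q i) b i).
  by apply: IH => l ls; apply: fb; rewrite inE ls orbT.
rewrite big_cons; case: ifPn => Qi.
  have -> : (fun w => \sum_(i <- i :: s | Q i) f i w) =
      (fun w => f i w + \sum_(i <- s | Q i) f i w).
    by apply/funext => w; rewrite big_cons Qi.
  by apply: mean_leD => //; apply: fb => //; rewrite mem_head.
have -> : (fun w => \sum_(i <- i :: s | Q i) f i w) =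
    (fun w => \sum_(i <- s | Q i) f i w).
  by apply/funext => w; rewrite big_cons (negbTE Qi).
exact: IH.
Qed.

Lemma mean_le_dom f g b : measurable_fun setT f ->
  (forall w, 0 <= f w <= g w) -> mean_le g b -> mean_le f b.
Proof.
move=> mf fg [mg g0 gb]; split => //; first by move=> w; case/andP: (fg w).
apply: le_trans gb; apply: ge0_le_integral => //.
- by move=> w _; rewrite lee_fin; case/andP: (fg w).
- exact/measurable_EFinP.
- exact/measurable_EFinP.
- by move=> w _; rewrite lee_fin; case/andP: (fg w).
Qed.

Lemma mean_le_le f b c : b <= c -> mean_le f b -> mean_le f c.
Proof.
by move=> bc [mf f0 fb]; split=> //; rewrite (le_trans fb)// lee_fin.
Qed.

Lemma mean_le_eq f g b : f =1 g -> mean_le f b -> mean_le g b.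
Proof. by move=> /funext ->. Qed.

End mean_le.

(** * Mixed exponential moments of the chaos densities *)

Section exponential_moments.
Context {R : realType} d (T : measurableType d) (P : probability T R).
Local Notation plane := (measurableTypeR R * measurableTypeR R)%type.
Variable W : set plane -> {RV P >-> measurableTypeR R}.
Hypothesis noiseW : white_noise W.

Let mW A : measurable_fun setT (fun w => W A w : R).
Proof. exact: (@measurable_funPT _ _ _ _ (W A)). Qed.

(** Three sets are enough: the densities at two points and one tangent factor. *)
Lemma white_noise_expR3_le (A B C : set plane) (a b c k v : R) :
  admissible A -> admissible B -> admissible C ->
  a ^+ 2 * fine (control_measure A) + b ^+ 2 * fine (control_measure B) +
  c ^+ 2 * fine (control_measure C) +
  2 * (a * b * fine (control_measure (A `&` B)) +
       a * c * fine (control_measure (A `&` C)) +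
       b * c * fine (control_measure (B `&` C))) <= 2 * v ->
  mean_le P (fun w => expR (a * W A w + b * W B w + c * W C w + k))
    (expR (v + k)).
Proof.
move=> admA admB admC hv.
have h : mean_le P (fun w => expR (a * W A w + b * W B w + c * W C w))
    (expR v).
  have mX : measurable_fun setT
      (fun w => a * (W A w : R) + b * (W B w : R) + c * (W C w : R)).
    by do ?[apply: measurable_funD]; apply: measurable_funM.
  split=> [|w|].
  - exact: measurableT_comp.
  - exact: expR_ge0.
  pose S (i : 'I_3) := nth set0 [:: A; B; C] i.
  pose f (i : 'I_3) := nth 0 [:: a; b; c] i.
  have admS i : admissible (S i).
    by case: i => -[|[|[|]]].
  have := white_noise_expR_le noiseW f admS.
  rewrite !big_ord_recl !big_ord0 /S /f /= !setIid !addr0.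
  rewrite (setIC B A) (setIC C A) (setIC C B).
  under eq_integral do rewrite !big_ord_recl big_ord0 /= addr0 addrA.
  move=> /le_trans; apply; rewrite lee_fin ler_expR ler_pdivrMr//.
  by apply: le_trans (le_trans _ hv) _; [lra|lra].
apply: (mean_le_eq _ (mean_le_le _ (mean_leZ (expR_ge0 k) h))) => [w|].
  by rewrite -expRD addrC.
by rewrite -expRD addrC.
Qed.

Variable gamma : R.

(** Built on [W] rather than on the continuous version, since the moment computations fix t and use
    the covariances of [W] directly. *)
Definition chaos_density m t w : R :=
  expR (gamma * W (cone m t) w - gamma ^+ 2 / 2 * cone_mass m).

Lemma ln2_le1 : ln 2 <= 1 :> R.
Proof. by have := @le_ln1Dx R 1; apply; lra. Qed.

Lemma mean_le_chaos_weight m j (t p b : R) : (j <= m)%N ->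
  mean_le P
    (fun w => chaos_density m t w * expR (p * (b + gamma * W (cone j t) w)))
    (expR (p * b + gamma ^+ 2 * cone_mass j * (p ^+ 2 / 2 + p))).
Proof.
move=> jm.
have IE : cone m t `&` cone j t = cone j t :> set plane.
  by apply/setIidPr; exact: subset_cone.
(* Only two exponentials occur; the third slot is filled with coefficient 0. *)
have := @white_noise_expR3_le (cone m t) (cone j t) (cone j t)
  gamma (p * gamma) 0 (p * b - gamma ^+ 2 / 2 * cone_mass m)
  (gamma ^+ 2 / 2 * cone_mass m +
   gamma ^+ 2 * cone_mass j * (p ^+ 2 / 2 + p))
  (admissible_cone _ _) (admissible_cone _ _) (admissible_cone _ _).
rewrite IE setIid !control_measure_cone /= => h.
apply: (mean_le_eq _ (mean_le_le _ (h _))); last by lra.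
- by move=> w; rewrite /chaos_density -expRD; congr expR; ring.
- by rewrite ler_expR; lra.
Qed.

(** The overlap of the two fine cones is bounded above, and the overlap of [cone m s] with the
    coarse cone below, because its coefficient p - 1 is nonpositive. The errors ln 2 <= 1 and 1 - p
    <= 1 add up to the constant 2. *)
Lemma mean_le_chaos_pair m j (s t p b : R) : (j <= m)%N -> 0 < p <= 1 ->
  `|s - t| <= 2 ^- j -> (j == m) || (2 ^- j.+1 <= `|s - t|) ->
  mean_le P
    (fun w => chaos_density m t w * chaos_density m s w *
              expR ((p - 1) * (b + gamma * W (cone j t) w)))
    (expR ((p - 1) * b +
       gamma ^+ 2 * (cone_mass j * (p ^+ 2 / 2 + p - 1 / 2) + 2))).
Proof.
move=> jm /andP[p0 p1] st1 st2.
have IE : cone m t `&` cone j t = cone j t :> set plane.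
  by apply/setIidPr; exact: subset_cone.
have := @white_noise_expR3_le (cone m t) (cone m s) (cone j t)
  gamma gamma ((p - 1) * gamma)
  ((p - 1) * b - gamma ^+ 2 * cone_mass m)
  (gamma ^+ 2 * cone_mass m +
   gamma ^+ 2 * (cone_mass j * (p ^+ 2 / 2 + p - 1 / 2) + 2))
  (admissible_cone _ _) (admissible_cone _ _) (admissible_cone _ _).
have adm m' u := admissible_cone m' u : admissible (cone m' u : set plane).
have := control_measure_coneI_le jm st2.
have := control_measure_coneI_ge jm st1.
rewrite IE !control_measure_cone /= (setIC (cone m t)).
rewrite (white_noise_covariance_fin noiseW (adm m s) (adm m t)).
rewrite (white_noise_covariance_fin noiseW (adm m s) (adm j t)) !lee_fin /=.
set x := fine _; set y := fine _ => hx hy h.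
apply: (mean_le_eq _ (mean_le_le _ (h _))).
- by move=> w; rewrite /chaos_density -!expRD; congr expR; field.
- by rewrite ler_expR; lra.
have yK : y <= cone_mass j + 1.
  apply: (le_trans hy); rewrite /cone_mass -natr1 mulrDl mul1r addrA lerD2l.
  exact: ln2_le1.
have xK : (1 - p) * (cone_mass j - 1) <= (1 - p) * x.
  by rewrite ler_wpM2l ?subr_ge0.
have g0 := sqr_ge0 gamma.
have key : y + (p - 1) * x <= p * cone_mass j + 2.
  move: (cone_mass j) yK xK {h} => K yK xK.
  lra.
have := ler_wpM2l g0 key.
by rewrite {g0 key yK xK h}; lra.
Qed.
End exponential_moments.

(** * Dyadic grids and scales *)

Section grid.
Context {R : realType}.

Definition grid (N i : nat) : R := i%:R * 2 ^- N.

(** The grid points of level N in the k-th half-open dyadic interval of level n. The subtraction is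
    truncated, so this reading needs n <= N. *)
Definition cell (N n k : nat) : seq nat :=
  index_iota (k * 2 ^ (N - n)) (k.+1 * 2 ^ (N - n)).

Lemma grid_dist N i j : `|grid N i - grid N j| = `|i%:R - j%:R| * 2 ^- N.
Proof. by rewrite -mulrBl normrM (ger0_norm (_ : 0 <= 2 ^- N))// invr_ge0. Qed.

Lemma exprB2 n N : (n <= N)%N -> (2 ^ (N - n))%:R * 2 ^- N = 2 ^- n :> R.
Proof.
by move=> nN; rewrite natrX -{2}(subnK nN) exprD invfM mulrA divff ?mul1r//.
Qed.

Lemma cell_dist N n k i j : (n <= N)%N -> i \in cell N n k ->
  j \in cell N n k -> `|grid N i - grid N j| <= 2 ^- n.
Proof.
move=> nN; rewrite !mem_index_iota mulSn => /andP[i1 i2] /andP[j1 j2].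
rewrite grid_dist -(exprB2 nN) ler_wpM2r ?invr_ge0 ?exprn_ge0//.
move: i1 i2 j1 j2; rewrite -!(ltr_nat R) -!(ler_nat R) natrD => i1 i2 j1 j2.
by rewrite ler_norml; lra.
Qed.

(** The last scale m collects all smaller distances, including 0: below the cut-off the field has no
    finer structure to separate. *)
Lemma dyadic_scale n m (x : R) : (n <= m)%N -> x <= 2 ^- n ->
  exists2 j, j \in index_iota n m.+1 &
    (x <= 2 ^- j) && ((j == m) || (2 ^- j.+1 <= x)).
Proof.
elim: m => [|m IH].
  rewrite leqn0 => /eqP-> x1; exists 0%N; first by rewrite mem_index_iota.
  by rewrite x1.
rewrite leq_eqVlt => /predU1P[-> x1|nm x1].
  exists m.+1; last by rewrite x1 eqxx.
  by rewrite mem_index_iota !leqnn.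
have [j] := IH nm x1; rewrite mem_index_iota ltnS => /andP[nj jm].
move=> /andP[xj /orP[/eqP jE|jx]]; last first.
  exists j; last by rewrite xj jx orbT.
  by rewrite mem_index_iota nj ltnS leqW.
have [xm|/ltW mx] := leP x (2 ^- m.+1).
  exists m.+1; last by rewrite xm eqxx.
  by rewrite mem_index_iota (ltnW nm) leqnn.
exists j; last by rewrite xj jE mx orbT.
by rewrite mem_index_iota nj ltnS leqW.
Qed.

(** At most 2 * 2^(N - j) + 1 <= 3 * 2^(N - j) points are counted; this is the origin of [ln 3] in
    [log_scale]. *)
Lemma cell_near_count N n k j i : (j <= N)%N ->
  \sum_(i' <- cell N n k | `|grid N i' - grid N i| <= 2 ^- j) 2 ^- N
    <= 3 * 2 ^- j :> R.
Proof.
move=> jN; rewrite -(exprB2 jN).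
have E i' : (`|grid N i' - grid N i| <= (2 ^ (N - j))%:R * 2 ^- N :> R) =
    (`|i'%:R - i%:R| <= (2 ^ (N - j))%:R :> R).
  by rewrite grid_dist ler_pM2r// invr_gt0 exprn_gt0.
under eq_bigl do rewrite E.
rewrite -[X in \sum_(_ <- _ | _) X]mul1r -mulr_suml mulrA ler_wpM2r//.
apply: le_trans (count_near_le _ _ _ _) _ => //.
have : 1 <= (2 ^ (N - j))%:R :> R by rewrite ler1n expn_gt0.
lra.
Qed.

Lemma cell_mass N n k : (n <= N)%N ->
  \sum_(i <- cell N n k) 2 ^- N = 2 ^- n :> R.
Proof.
move=> nN; rewrite -(exprB2 nN) sumr_const_nat mulSn addnK.
by rewrite mulr_natl.
Qed.

End grid.

(** * Moments of the Riemann sums over dyadic intervals *)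

Section chaos_moments.
Context {R : realType} d (T : measurableType d) (P : probability T R).
Local Notation plane := (measurableTypeR R * measurableTypeR R)%type.
Variable W : set plane -> {RV P >-> measurableTypeR R}.
Hypothesis noiseW : white_noise W.
Variables (gamma p : R).
Hypothesis p01 : 0 < p <= 1.

Definition chaos_sum m N n k w : R :=
  \sum_(i <- cell N n k) 2 ^- N * chaos_density W gamma m (grid N i) w.

(* Logarithm of the tangency point c_j, chosen so that both terms of the tangent
   have the same mean bound [scale_moment j]. *)
Definition log_scale (j : nat) : R :=
  ln 3 - j%:R * ln 2 + gamma ^+ 2 * (2 - cone_mass j / 2).

Definition scale_moment (j : nat) : R :=
  expR (p * log_scale j + gamma ^+ 2 * cone_mass j * (p ^+ 2 / 2 + p)).

Lemma measurable_chaos_density m t :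
  measurable_fun setT (chaos_density W gamma m t).
Proof.
apply: measurableT_comp => //; apply: measurable_funB => //.
by apply: measurable_funM => //; exact: (@measurable_funPT _ _ _ _ (W _)).
Qed.

Lemma measurable_chaos_sum m N n k : measurable_fun setT (chaos_sum m N n k).
Proof.
apply: measurable_sum => i; apply: measurable_funM => //.
exact: measurable_chaos_density.
Qed.

Lemma chaos_sum_ge0 m N n k w : 0 <= chaos_sum m N n k w.
Proof.
by apply: sumr_ge0 => i _; rewrite mulr_ge0 ?expR_ge0.
Qed.

Lemma expR_log_scale j :
  expR (log_scale j) = 3 * 2 ^- j * expR (gamma ^+ 2 * (2 - cone_mass j / 2)).
Proof.
rewrite /log_scale !expRD lnK ?posrE// expRN; congr (_ * _^-1 * _).
by rewrite expRM_natl lnK// posrE.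
Qed.

Lemma mean_le_chaos_sum m n N k : (n <= m)%N -> (m <= N)%N ->
  mean_le P (fun w => chaos_sum m N n k w `^ (1 + p))
    (2 ^- n * \sum_(n <= j < m.+1) scale_moment j).
Proof.
move=> nm mN; have nN := leq_trans nm mN.
have /andP[p0 p1] := p01.
have h0 : 0 <= 2 ^- N :> R by rewrite invr_ge0 exprn_ge0.
pose rel (j i i' : nat) := (`|grid N i' - grid N i| <= 2 ^- j :> R) &&
  ((j == m) || (2 ^- j.+1 <= `|grid N i' - grid N i| :> R)).
pose a i w := 2 ^- N * chaos_density W gamma m (grid N i) w.
pose b j i w := log_scale j + gamma * W (cone j (grid N i)) w.
apply: (@mean_le_dom _ _ _ _ _ (fun w =>
  \sum_(i <- cell N n k) \sum_(j <- index_iota n m.+1)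
    ((1 - p) * (a i w * expR (p * b j i w)) +
     p * \sum_(i' <- cell N n k | rel j i i')
       a i w * a i' w * expR ((p - 1) * b j i w)))).
- apply: (measurableT_comp (measurable_powR (1 + p))).
  exact: measurable_chaos_sum.
- move=> w; rewrite powR_ge0/=.
  apply: (powR_sum_tangent (rel := rel) (a := a ^~ w)
    (fun j i => b j i w)) => //.
    by move=> i; rewrite mulr_ge0// expR_ge0.
  move=> i i' ci ci'; have := cell_dist (R := R) nN ci' ci.
  by move=> /(dyadic_scale nm)[j jn hj]; exists j.
rewrite -(cell_mass k nN) mulr_suml.
apply: mean_le_sum => i ci _; rewrite mulr_sumr.
apply: mean_le_sum => j; rewrite mem_index_iota ltnS => /andP[nj jm] _.
have jN := leq_trans jm mN.
pose B := gamma ^+ 2 * cone_mass j * (p ^+ 2 / 2 + p).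
pose B2 := gamma ^+ 2 * (cone_mass j * (p ^+ 2 / 2 + p - 1 / 2) + 2).
have -> : 2 ^- N * scale_moment j = (1 - p) * (2 ^- N * scale_moment j) +
    p * (2 ^- N * scale_moment j) by ring.
apply: mean_leD.
  apply: mean_leZ; first by rewrite subr_ge0.
  have := mean_leZ h0 (mean_le_chaos_weight noiseW gamma (grid N i) p
    (log_scale j) jm).
  by apply: mean_le_eq => w; rewrite mulrA.
apply: mean_leZ; first exact: ltW.
(* The pair bound does not depend on i', so only the number of grid points in the annulus remains to
   be counted. *)
apply: (@mean_le_le _ _ _ _ _ (\sum_(i' <- cell N n k | rel j i i')
    2 ^- N * 2 ^- N * expR ((p - 1) * log_scale j + B2))); last first.
  apply: mean_le_sum => i' _ /andP[r1 r2].
  have := mean_leZ (mulr_ge0 h0 h0) (mean_le_chaos_pair noiseW gamma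
    (log_scale j) jm p01 r1 r2).
  by apply: mean_le_eq => w; rewrite /a; ring.
rewrite -mulr_suml -mulr_sumr -mulrA ler_wpM2l//.
(* The difference of the exponents, B - B2 = gamma^2 (cone_mass j / 2 - 2), is cancelled by the last
   term of [log_scale], and the factor 3 * 2^-j is the annulus count. *)
have -> : scale_moment j =
    3 * 2 ^- j * expR ((p - 1) * log_scale j + B2).
  have -> : scale_moment j =
      expR (log_scale j) * expR ((p - 1) * log_scale j + B).
    by rewrite -expRD; congr expR; rewrite /B; ring.
  rewrite expR_log_scale -[LHS]mulrA -expRD; congr (_ * expR _).
  by rewrite /B /B2; field.
rewrite ler_wpM2r ?expR_ge0//; apply: le_trans (cell_near_count n k i jN).
rewrite big_mkcond [leRHS]big_mkcond /=; apply: ler_sum => i' _.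
by rewrite /rel; case: ifP => [/andP[-> _]//|_]; case: ifP.
Qed.

End chaos_moments.

(** * Lower limits and bounds that hold infinitely often *)

Section frequently.
Context {R : realType}.

Lemma limn_einfE (u : (\bar R)^nat) : limn_einf u = ereal_sup (range (einfs u)).
Proof.
rewrite limn_einf_lim; apply/cvg_lim => //.
by apply: ereal_nondecreasing_cvgn; exact: nondecreasing_einfs.
Qed.

Lemma limn_einf_lt_frequently (u : (\bar R)^nat) (K : \bar R) m0 :
  (limn_einf u < K)%E -> exists2 m, (m0 <= m)%N & (u m < K)%E.
Proof.
move=> uK; apply: contrapT => h.
suff : (K <= limn_einf u)%E by rewrite leNgt uK.
rewrite limn_einfE; apply: le_trans (ereal_sup_ubound _); last by exists m0.
apply: le_ereal_inf_tmp => _ [m /= m0m <-]; rewrite leNgt; apply/negP => umK.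
by apply: h; exists m.
Qed.

Lemma limn_einf_le_frequently (u : (\bar R)^nat) (K : \bar R) :
  (forall m0, exists2 m, (m0 <= m)%N & (u m <= K)%E) -> (limn_einf u <= K)%E.
Proof.
move=> h; rewrite limn_einfE; apply: ge_ereal_sup => _ [m0 _ <-].
have [m m0m umK] := h m0; apply: le_trans umK.
by apply: ereal_inf_lbound; exists m.
Qed.

Lemma limn_einf_ge_eventually (u : (\bar R)^nat) (y : R) :
  (forall e, 0 < e -> exists m0, forall m, (m0 <= m)%N ->
    ((y - e)%:E <= u m)%E) -> (y%:E <= limn_einf u)%E.
Proof.
move=> h; apply/lee_subgt0Pr => e /h[m0 hm0]; rewrite limn_einfE -EFinB.
apply: le_trans (ereal_sup_ubound _); last by exists m0.
by apply: le_ereal_inf_tmp => _ [m /= m0m <-]; exact: hm0.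
Qed.

Context d (T : measurableType d) (P : probability T R).

Lemma measurable_fun_limn_einf (f : (T -> \bar R)^nat) :
  (forall n, measurable_fun setT (f n)) ->
  measurable_fun setT (fun x => limn_einf (f^~ x)).
Proof.
move=> mf; have -> : (fun x => limn_einf (f^~ x)) =
    (fun x => (- limn_esup (fun n => - f n x))%E).
  apply/funext => x; rewrite -limn_einfN; congr limn_einf.
  by apply/funext => n /=; rewrite oppeK.
apply: measurableT_comp => //; apply: measurable_fun_limn_esup => n.
exact: measurableT_comp.
Qed.

(** The iterated lower limit, in N and then in m, has expectation at most C and is therefore finite
    almost everywhere. The suitable N may depend on m. *)
Lemma ae_frequently_bounded (f : nat -> nat -> T -> R) (C : R) :
  (forall m N, mean_le P (f m N) C) ->
  {ae P, forall w, exists K : R, forall m0, exists2 m, (m0 <= m)%N &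
    forall N0, exists2 N, (N0 <= N)%N & f m N w <= K}.
Proof.
move=> fC.
pose F m N w := (f m N w)%:E.
have mF m N : measurable_fun setT (F m N).
  by apply/measurable_EFinP; have [] := fC m N.
have F0 m N w : (0 <= F m N w)%E by rewrite lee_fin; have [_ ->] := fC m N.
pose G m w := limn_einf (F m ^~ w).
have mG m : measurable_fun setT (G m) by exact: measurable_fun_limn_einf.
have liminf0 u : (forall n, 0 <= u n)%E -> (0 <= limn_einf u :> \bar R)%E.
  move=> u0; apply: limn_einf_ge_eventually => e e0; exists 0%N => n _.
  by apply: le_trans (u0 n); rewrite lee_fin sub0r oppr_le0 ltW.
have G0 m w : (0 <= G m w)%E by exact: liminf0.
have intG m : (\int[P]_w G m w <= C%:E)%E.
  apply: le_trans (fatou P measurableT (mF m) _) _ => //.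
  apply: limn_einf_le_frequently => N0; exists N0 => //.
  by have [] := fC m N0.
have intH : (\int[P]_w limn_einf (G ^~ w) <= C%:E)%E.
  apply: le_trans (fatou P measurableT mG _) _ => //.
  by apply: limn_einf_le_frequently => m0; exists m0.
have : P.-integrable setT (fun w => limn_einf (G ^~ w)).
  apply/integrableP; split; first exact: measurable_fun_limn_einf.
  under eq_integral do rewrite gee0_abs ?liminf0//.
  by apply: le_lt_trans intH _; rewrite ltry.
move=> /(integrable_ae measurableT); apply: filterS => w /(_ I) fin.
(* The added 1 makes the inequality strict, which forces infinitely many terms below the bound. *)
exists (fine (limn_einf (G ^~ w)) + 1) => m0.
have : (limn_einf (G ^~ w) < (fine (limn_einf (G ^~ w)) + 1)%:E)%E.
  by rewrite EFinD fineK// lteDl.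
move=> /(limn_einf_lt_frequently m0)[m m0m GK]; exists m => // N0.
have [N N0N FK] := limn_einf_lt_frequently N0 GK.
by exists N => //; move: FK; rewrite lte_fin => /ltW.
Qed.

End frequently.

(** * Almost sure bounds on all dyadic intervals at once *)

Section chaos_bounded.
Context {R : realType} d (T : measurableType d) (P : probability T R).
Local Notation plane := (measurableTypeR R * measurableTypeR R)%type.
Variable W : set plane -> {RV P >-> measurableTypeR R}.
Hypothesis noiseW : white_noise W.
Variables (gamma p alpha : R).
Hypothesis p01 : 0 < p <= 1.
Hypothesis gamma_p : gamma ^+ 2 * (1 + p) < 2.
Hypothesis alpha_p : alpha * (1 + p) < p * (1 - gamma ^+ 2 * (1 + p) / 2).

Lemma sum_geometric_le (r : R) n m : 0 < r < 1 -> (n <= m)%N ->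
  \sum_(n <= j < m) r ^+ j <= r ^+ n / (1 - r).
Proof.
move=> /andP[r0 r1] nm; rewrite ler_pdivlMr ?subr_gt0//.
have -> : (\sum_(n <= j < m) r ^+ j) * (1 - r) = r ^+ n - r ^+ m.
  have /= := telescope_sumr (fun j => - r ^+ j) nm.
  rewrite opprK addrC => <-; rewrite mulr_suml; apply: eq_bigr => j _.
  by rewrite exprS; ring.
by rewrite lerBlDr lerDl exprn_ge0// ltW.
Qed.

Let ratio := expR (- (ln 2 * (p * (1 - gamma ^+ 2 * (1 + p) / 2)))).

Let ln2_gt0 : 0 < ln 2 :> R. Proof. by rewrite ln_gt0// ltr1n. Qed.

Let ratio01 : 0 < ratio < 1.
Proof.
have h : 0 < 1 - gamma ^+ 2 * (1 + p) / 2.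
  by rewrite subr_gt0 ltr_pdivrMr// mul1r.
by rewrite expR_gt0 expR_lt1 oppr_lt0 !mulr_gt0//; case/andP: p01.
Qed.

Let scale :=
  expR (p * ln 3 + 2 * p * gamma ^+ 2 + gamma ^+ 2 * (p ^+ 2 + p) / 2).

Let scale_momentE j : scale_moment gamma p j = scale * ratio ^+ j.
Proof.
rewrite /ratio -expRM_natl -expRD /scale_moment /log_scale /cone_mass.
by congr expR; field.
Qed.

(** This is 2^(alpha (1 + p)), whose n-th power becomes 2^(alpha n) after the (1 + p)-th root is
    taken. *)
Definition level_weight : R := expR (ln 2 * (alpha * (1 + p))).

(** The 2^n cells of level n cancel the factor 2^-n of each moment. What is left is a geometric
    series of ratio [level_weight * ratio], which is less than 1 by [alpha_p]. *)
Lemma mean_le_weighted_chaos_sum m N : (m <= N)%N ->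
  mean_le P
    (fun w => \sum_(0 <= n < m.+1) \sum_(0 <= k < 2 ^ n)
      level_weight ^+ n * chaos_sum W gamma m N n k w `^ (1 + p))
    (scale / (1 - ratio) / (1 - level_weight * ratio)).
Proof.
move=> mN; have /andP[r0 r1] := ratio01.
have w0 : 0 < level_weight by exact: expR_gt0.
have wr : 0 < level_weight * ratio < 1.
  rewrite mulr_gt0//= -expRD expR_lt1 -mulrN -mulrDr.
  by rewrite pmulr_rlt0// subr_lt0.
apply: (@mean_le_le _ _ _ _ _ (\sum_(0 <= n < m.+1) \sum_(0 <= k < 2 ^ n)
    level_weight ^+ n *
      (2 ^- n * (scale * (ratio ^+ n / (1 - ratio)))))); last first.
  apply: mean_le_sum => n; rewrite mem_index_iota/= ltnS => nm _.
  apply: mean_le_sum => k _ _; apply: mean_leZ.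
    by rewrite exprn_ge0// ltW.
  apply: mean_le_le (mean_le_chaos_sum noiseW gamma p01 k nm mN).
  rewrite ler_wpM2l ?invr_ge0 ?exprn_ge0//.
  under eq_bigr do rewrite scale_momentE.
  by rewrite -mulr_sumr ler_wpM2l ?expR_ge0// sum_geometric_le// leqW.
have -> : \sum_(0 <= n < m.+1) \sum_(0 <= k < 2 ^ n)
    level_weight ^+ n * (2 ^- n * (scale * (ratio ^+ n / (1 - ratio)))) =
    scale / (1 - ratio) * \sum_(0 <= n < m.+1) (level_weight * ratio) ^+ n.
  rewrite mulr_sumr; apply: eq_bigr => n _.
  rewrite sumr_const_nat subn0 -[LHS]mulr_natr natrX exprMn.
  by field; rewrite subr_eq0 gt_eqF//= expf_neq0 ?pnatr_eq0.
rewrite ler_wpM2l ?divr_ge0 ?expR_ge0 ?subr_ge0 ?(ltW r1)//.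
by apply: le_trans (sum_geometric_le wr (leq0n _)) _; rewrite expr0 mul1r.
Qed.

Lemma ae_chaos_sum_bounded :
  {ae P, forall w, exists K : R, 0 <= K /\ forall m0, exists2 m, (m0 <= m)%N &
    forall N0, exists N, [/\ (N0 <= N)%N, (m <= N)%N &
      forall n k, (n <= m)%N -> (k < 2 ^ n)%N ->
        chaos_sum W gamma m N n k w <= K * expR (- (ln 2 * alpha * n%:R))]}.
Proof.
(* Indexing the mesh by m + N keeps it at least as fine as the cut-off, as the moment bound
   requires. *)
have := @ae_frequently_bounded _ _ _ P (fun m N w =>
    \sum_(0 <= n < m.+1) \sum_(0 <= k < 2 ^ n)
      level_weight ^+ n * chaos_sum W gamma m (m + N) n k w `^ (1 + p))
   _ (fun m N => mean_le_weighted_chaos_sum (leq_addr N m)).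
apply: filterS => w [K hK].
(* All terms of the weighted sum are nonnegative, so each is at most K; the maximum with 0 makes the
   root monotone and multiplicative without a sign condition on K. *)
exists (Num.max 0 K `^ (1 + p)^-1); split; first exact: powR_ge0.
move=> m0; have [m m0m hm] := hK m0; exists m => // N0.
have [N N0N hN] := hm N0; exists (m + N)%N; split.
- exact: leq_trans (leq_addl _ _).
- exact: leq_addr.
move=> n k nm kn; set S := chaos_sum _ _ _ _ _ _ _.
have q0 : 0 < 1 + p by have /andP[p0 _] := p01; rewrite addr_gt0.
have term0 n' k' : 0 <= level_weight ^+ n' *
    chaos_sum W gamma m (m + N) n' k' w `^ (1 + p).
  by rewrite mulr_ge0 ?powR_ge0// exprn_ge0// expR_ge0.
have SK : level_weight ^+ n * S `^ (1 + p) <= Num.max 0 K.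
  rewrite le_max; apply/orP; right; apply: le_trans hN.
  rewrite (big_rem n) ?mem_index_iota//= (big_rem k) ?mem_index_iota//=.
  by rewrite -addrA lerDl addr_ge0// sumr_ge0// => *; apply: sumr_ge0.
have S0 : 0 <= S by exact: chaos_sum_ge0.
have -> : S = (S `^ (1 + p)) `^ (1 + p)^-1.
  by rewrite -powRrM divff ?powRr1// gt_eqF.
have -> : expR (- (ln 2 * alpha * n%:R)) = (level_weight ^+ n)^-1 `^ (1 + p)^-1.
  rewrite /level_weight -expRM_natl -expRN -expRM; congr expR.
  by field; rewrite gt_eqF.
rewrite -powRM ?le_max ?lexx//; last by rewrite invr_ge0 exprn_ge0// expR_ge0.
apply: ge0_ler_powR; rewrite ?nnegrE ?invr_ge0 ?(ltW q0) ?powR_ge0//.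
  by rewrite mulr_ge0 ?le_max ?lexx// invr_ge0 exprn_ge0// expR_ge0.
by rewrite ler_pdivlMr 1?mulrC// exprn_gt0// expR_gt0.
Qed.

End chaos_bounded.

(** * From Riemann sums to integrals over dyadic intervals *)

Section cells.
Context {R : realType}.
Local Notation leb := (@lebesgue_measure R).

Definition cell_itv (n k : nat) : set (measurableTypeR R) :=
  `[grid n k, grid n k.+1[%classic.

Lemma exprV2_lt (x : R) : 0 < x -> exists N, 2 ^- N < x.
Proof.
move=> x0; exists (Num.truncn x^-1).+1; rewrite -[ltRHS]invrK.
rewrite ltf_pV2 ?posrE ?exprn_gt0 ?invr_gt0//.
have /andP[_ h] : (Num.truncn x^-1)%:R <= x^-1 < (Num.truncn x^-1).+1%:R.
  by apply: truncn_itv; rewrite invr_ge0 ltW.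
by apply: (lt_trans h); rewrite -natrX ltr_nat ltn_expl.
Qed.

Lemma gridS N i : grid N i.+1 = grid N i + 2 ^- N :> R.
Proof. by rewrite /grid -[i.+1%:R]natr1 mulrDl mul1r. Qed.

Lemma measurable_cell_itv n k : measurable (cell_itv n k).
Proof. exact: measurable_itv. Qed.

Lemma grid_ge0 N i : 0 <= grid N i :> R.
Proof. by rewrite mulr_ge0// invr_ge0 exprn_ge0. Qed.

Lemma grid_le1 N i : (i <= 2 ^ N)%N -> grid N i <= 1 :> R.
Proof. by move=> iN; rewrite ler_pdivrMr ?exprn_gt0// mul1r -natrX ler_nat. Qed.

Lemma cell_itv_sub n k : (k < 2 ^ n)%N -> cell_itv n k `<=` `[0%R, 1%R].
Proof.
move=> kn x; rewrite /cell_itv /= !in_itv/= => /andP[x1 x2].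
rewrite (le_trans (grid_ge0 _ _) x1)/=.
by rewrite (le_trans (ltW x2))// grid_le1.
Qed.

Lemma grid_cover N (x : R) : 0 <= x ->
  cell_itv N (Num.truncn (x * 2 ^+ N)) x.
Proof.
move=> x0; have xN : 0 <= x * 2 ^+ N by rewrite mulr_ge0// exprn_ge0.
have /andP[h1 h2] := truncn_itv xN.
rewrite /cell_itv /= in_itv/= ler_pdivrMr ?exprn_gt0// h1.
by rewrite ltr_pdivlMr ?exprn_gt0.
Qed.

Lemma mem_cell N n k i (x : R) : (n <= N)%N -> cell_itv n k x ->
  cell_itv N i x -> i \in cell N n k.
Proof.
move=> nN; rewrite /cell_itv /= !in_itv/= => /andP[k1 k2] /andP[i1 i2].
have N0 : 0 < 2 ^- N :> R by rewrite invr_gt0 exprn_gt0.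
have gridE l : grid n l = (l * 2 ^ (N - n))%:R * 2 ^- N :> R.
  by rewrite natrM -mulrA exprB2.
rewrite mem_index_iota; apply/andP; split.
  by have := le_lt_trans k1 i2; rewrite gridE ltr_pM2r// ltr_nat ltnS.
by have := le_lt_trans i1 k2; rewrite gridE ltr_pM2r// ltr_nat.
Qed.

Lemma cell_itv_measure N i : leb (cell_itv N i) = (2 ^- N)%:E.
Proof.
have N0 : 0 < 2 ^- N :> R by rewrite invr_gt0 exprn_gt0.
rewrite /cell_itv lebesgue_measure_itv/= lte_fin gridS.
by rewrite ltrDl N0 -EFinB addrC addKr.
Qed.

(** By continuity, the lower limit of the left-endpoint step functions is at least g on the cell;
    Fatou's lemma then bounds the integral by the lower limit of the Riemann sums, so infinitely
    many meshes suffice. *)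
Lemma integral_cell_le (g : R -> R) n k (X : R) :
  {within `[0, 1], continuous g} -> (forall x, 0 <= g x) -> (k < 2 ^ n)%N ->
  (forall N0, exists N, [/\ (N0 <= N)%N, (n <= N)%N &
    \sum_(i <- cell N n k) 2 ^- N * g (grid N i) <= X]) ->
  (\int[leb]_(x in cell_itv n k) (g x)%:E <= X%:E)%E.
Proof.
move=> cg g0 kn hX.
pose step N x := (\sum_(i <- cell N n k)
  (g (grid N i))%:E * (\1_(cell_itv N i) x)%:E)%E.
have mstep1 N i : measurable_fun setT
    (fun x => (g (grid N i))%:E * (\1_(cell_itv N i) x)%:E)%E.
  apply: emeasurable_funM => //; apply/measurable_EFinP/measurable_indic.
  exact: measurable_cell_itv.
have step10 N i x : (0 <= (g (grid N i))%:E * (\1_(cell_itv N i) x)%:E)%E.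
  by rewrite -EFinM lee_fin mulr_ge0.
have mstep N : measurable_fun setT (step N) by exact: emeasurable_sum.
have step0 N x : (0 <= step N x)%E by apply: sume_ge0.
have intstep N : (\int[leb]_x step N x =
    (\sum_(i <- cell N n k) 2 ^- N * g (grid N i))%:E)%E.
  rewrite ge0_integral_sum// -sumEFin; apply: eq_bigr => i _.
  rewrite ge0_integralZl_EFin//; last first.
    by apply/measurable_EFinP/measurable_indic; exact: measurable_cell_itv.
  rewrite integral_indic//; last exact: measurable_cell_itv.
  rewrite setIT [X in (_ * X)%E](_ : _ = (2 ^- N)%:E) -?EFinM 1?mulrC//.
  exact: cell_itv_measure.
have mgI : measurable_fun (cell_itv n k) (fun x => (g x)%:E).
  have mg : measurable_fun (`[0%R, 1%R] : set (measurableTypeR R)) g.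
    exact: subspace_continuous_measurable_fun.
  apply/measurable_EFinP; apply: measurable_funS mg => //.
  exact: cell_itv_sub.
rewrite integral_mkcond.
apply: (@le_trans _ _ (\int[leb]_x limn_einf (step ^~ x))%E).
  apply: ge0_le_integral => //.
  - by move=> x _; rewrite patchE; case: ifP => // _; rewrite lee_fin.
  - by apply/(measurable_restrictT _ (measurable_cell_itv n k)).
  - exact: measurable_fun_limn_einf.
  move=> x _; rewrite patchE; case: ifPn => [|_]; last first.
    apply: limn_einf_ge_eventually => e e0; exists 0%N => N _.
    by apply: le_trans (step0 N x); rewrite lee_fin sub0r oppr_le0 ltW.
  rewrite inE => Ix; have x01 := cell_itv_sub kn Ix.
  apply: limn_einf_ge_eventually => e e0.
  have /cvgrPdist_lt /(_ _ e0) := (subspace_continuousP _ _).1 cg x x01.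
  rewrite near_withinE => /nbhs_ballP[del /= del0 hdel].
  have [N1 hN1] := exprV2_lt del0.
  exists (maxn n N1) => N; rewrite geq_max => /andP[nN N1N].
  set i := Num.truncn (x * 2 ^+ N).
  have x0 : 0 <= x by move: x01; rewrite /= in_itv/= => /andP[].
  have iN := grid_cover N x0; have ci := mem_cell nN Ix iN.
  have iN1 : grid N i < 1 :> R.
    have : (i < 2 ^ N)%N.
      move: ci; rewrite mem_index_iota => /andP[_ /leq_trans]; apply.
      by rewrite -{2}(subnKC nN) expnD leq_mul2r kn orbT.
    by move=> ?; rewrite /grid ltr_pdivrMr ?exprn_gt0// mul1r -natrX ltr_nat.
  have dist : `|x - grid N i| < del.
    apply: le_lt_trans hN1; apply: (@le_trans _ _ (2 ^- N)).
      move: iN; rewrite /cell_itv /= in_itv/= => /andP[h1].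
      by rewrite gridS ger0_norm ?subr_ge0// lerBlDl => /ltW.
    by rewrite lef_pV2 ?posrE ?exprn_gt0// ler_weXn2l// ler1n.
  have hg : `|g x - g (grid N i)| < e.
    by apply: hdel => //; rewrite /= in_itv/= grid_ge0 ltW.
  apply: (@le_trans _ _ (g (grid N i))%:E).
    by rewrite lee_fin lerBlDr -lerBlDl ltW// (le_lt_trans (ler_norm _)).
  rewrite /step (big_rem i)//= indicE mem_set// mule1 leeDl//.
  exact: sume_ge0.
apply: le_trans (fatou leb measurableT mstep _) _ => //.
apply: limn_einf_le_frequently => N0; have [N [N0N _ hN]] := hX N0.
by exists N => //; rewrite intstep lee_fin.
Qed.

(** Turns the set function into a bundled measure, so that monotonicity, Boole's inequality and
    integration against it become available. *)
Lemma density_measure (g : R -> R) :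
  measurable_fun (`[0%R, 1%R] : set (measurableTypeR R)) g ->
  (forall x, 0 <= g x) ->
  exists M : {measure set (measurableTypeR R) -> \bar R},
    forall A, M A = (\int[leb]_(t in A `&` `[0%R, 1%R]) (g t)%:E)%E.
Proof.
move=> mg g0.
pose F (A : set (measurableTypeR R)) :=
  (\int[leb]_(t in A `&` `[0%R, 1%R]) (g t)%:E)%E.
have F0 : F set0 = 0%E by rewrite /F set0I integral_set0.
have Fge0 A : (0 <= F A)%E by apply: integral_ge0 => x _; rewrite lee_fin.
have Fadd : semi_sigma_additive F.
  move=> A mA tA mUA.
  rewrite /F setI_bigcupl ge0_integral_bigcup//=; first last.
  - exact: trivIset_setIr.
  - by move=> x _; rewrite lee_fin.
  - apply/measurable_EFinP; rewrite -setI_bigcupl.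
    by apply: measurable_funS mg => //; apply: subIsetr.
  - by move=> i; apply: measurableI.
  apply: is_cvg_ereal_nneg_natsum_cond => i _ _; exact: Fge0.
pose M : {measure set (measurableTypeR R) -> \bar R} :=
  HB.pack F (isMeasure.Build _ _ _ F F0 Fge0 Fadd).
by exists M.
Qed.

End cells.

(** * From dyadic intervals to all intervals, and passage to the weak limit *)

Section frostman.
Context {R : realType}.
Local Notation leb := (@lebesgue_measure R).

Lemma measurable_ball_le (a r : R) :
  measurable ([set x | `|x - a| <= r] : set (measurableTypeR R)).
Proof.
have -> : [set x | `|x - a| <= r] = `[a - r, a + r]%classic.
  apply/seteqP; split => x; rewrite /= in_itv/= ler_norml => /andP[h1 h2].
    by apply/andP; split; lra.
  by apply/andP; split; lra.
exact: measurable_itv.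
Qed.

(** A cell meeting the window has its left end within 3 * 2^-n of a, and at most 2 * 3 + 1 = 7
    integers lie within 3 of a given real. *)
Lemma density_measure_window (g : R -> R) n (X a : R)
    (M : {measure set (measurableTypeR R) -> \bar R}) :
  (forall A, M A = (\int[leb]_(t in A `&` `[0%R, 1%R]) (g t)%:E)%E) ->
  0 <= X ->
  (forall k, (k < 2 ^ n)%N ->
    (\int[leb]_(t in cell_itv n k) (g t)%:E <= X%:E)%E) ->
  (M [set x | (`|x - a| <= 2 * 2 ^- n)%R] <= (7 * X)%:E)%E.
Proof.
move=> ME X0 gX; set J : set (measurableTypeR R) := [set x | _].
have n0 : 0 < 2 ^- n :> R by rewrite invr_gt0 exprn_gt0.
have mJ : measurable J by exact: measurable_ball_le.
have m01 : measurable (`[0%R, 1%R] : set (measurableTypeR R)).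
  exact: measurable_itv.
pose near (k : nat) := `|k%:R - a * 2 ^+ n| <= 3.
(* The point 1 lies in none of the half-open cells of index below 2^n; the extra index 2^n covers it
   by a null set. *)
pose A k : set (measurableTypeR R) := if k == (2 ^ n)%N then [set 1]
  else if near k then cell_itv n k else set0.
have mA k : measurable (A k).
  rewrite /A; case: ifP => _; first exact: measurable_set1.
  by case: ifP => _ //; exact: measurable_cell_itv.
have cover : J `&` `[0%R, 1%R] `<=` \big[setU/set0]_(k < (2 ^ n).+1) A k.
  rewrite -bigcup_mkord => x [Jx]; rewrite /= in_itv/= => /andP[x0].
  rewrite le_eqVlt => /predU1P[->|x1].
    by exists (2 ^ n)%N => //=; rewrite /A eqxx.
  have xk := grid_cover n x0; set k := Num.truncn _ in xk.
  have kx : grid n k <= x < grid n k.+1.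
    by move: xk; rewrite /cell_itv /= in_itv.
  have kn : (k < 2 ^ n)%N.
    have /andP[h _] := kx; have := le_lt_trans h x1.
    by rewrite /grid ltr_pdivrMr ?exprn_gt0// mul1r -natrX ltr_nat.
  exists k => //=; first by rewrite ltnS ltnW.
  rewrite /A ltn_eqF// ifT// /near.
  have -> : k%:R - a * 2 ^+ n = (grid n k - a) * 2 ^+ n.
    by rewrite mulrBl /grid divfK// expf_neq0// pnatr_eq0.
  rewrite normrM (ger0_norm (exprn_ge0 _ _))// -ler_pdivlMr ?exprn_gt0//.
  move: Jx kx; rewrite /J /= gridS !ler_norml => /andP[h1 h2] /andP[h3 h4].
  by apply/andP; split; lra.
have -> : M J = M (J `&` `[0%R, 1%R]) by rewrite !ME -setIA setIid.
have mU : measurable (\big[setU/set0]_(k < (2 ^ n).+1) A k).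
  by apply: bigsetU_measurable => k _.
apply: le_trans (le_measure M _ _ cover) _; rewrite ?inE//.
  exact: measurableI.
apply: le_trans (Boole_inequality M _) _ => //.
rewrite big_ord_recr/= [X in (_ + X)%E](_ : _ = 0%E) ?adde0; last first.
  by rewrite ME /A eqxx; apply: integral_Sset1; exact: subIsetl.
apply: (@le_trans _ _ (\sum_(k < 2 ^ n) (if near k then X else 0)%:E)%E).
  apply: lee_sum => k _; rewrite /A ltn_eqF// fun_if measure0 ME.
  have /setIidPl -> := @cell_itv_sub R _ _ (ltn_ord k).
  by case: ifP => _ //; exact: gX.
rewrite sumEFin lee_fin -(big_mkord xpredT (fun k => if near k then X else 0)).
rewrite -big_mkcond/= -[X in \sum_(_ <- _ | _) X]mul1r -mulr_suml.
rewrite ler_wpM2r//; apply: le_trans (count_near_le _ _ _ _) _ => //; lra.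
Qed.

(** A trapezoidal test function: it is 1 within 2^-n of a and vanishes beyond twice that
    distance. *)
Definition bump (a : R) n (x : R) : R :=
  Num.max 0 (Num.min 1 (2 - 2 ^+ n * `|x - a|)).

Lemma continuous_bump a n : continuous (bump a n).
Proof.
have cl : continuous (fun x : R => 2 - 2 ^+ n * `|x - a|).
  move=> x; apply: cvgB; first exact: cvg_cst.
  apply: cvgM; first exact: cvg_cst.
  apply: cvg_norm; apply: cvgB; [exact: cvg_id|exact: cvg_cst].
have c0 (c : R) : continuous (fun _ : R => c) by exact: cst_continuous.
exact: (@max_fun_continuous _ R R _ _ (c0 0)
  (@min_fun_continuous _ R R _ _ (c0 1) cl)).
Qed.

Lemma bump_ge0 a n x : 0 <= bump a n x.
Proof. by rewrite le_max lexx. Qed.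

Lemma bump_le1 a n x : bump a n x <= 1.
Proof. by rewrite ge_max ler01 ge_min lexx. Qed.

Lemma upper_frostman_of_cells (g : nat -> R -> R)
    (nu : {measure set (measurableTypeR R) -> \bar R}) (K beta alpha : R) :
  (forall m, {within `[0, 1], continuous (g m)}) ->
  (forall m x, 0 <= g m x) ->
  weakly_converges (fun m A =>
    (\int[leb]_(t in A `&` `[0%R, 1%R]) (g m t)%:E)%E) nu ->
  0 <= K ->
  (forall m0, exists2 m, (m0 <= m)%N &
    forall N0, exists N, [/\ (N0 <= N)%N, (m <= N)%N &
      forall n k, (n <= m)%N -> (k < 2 ^ n)%N ->
        \sum_(i <- cell N n k) 2 ^- N * g m (grid N i) <=
        K * expR (- (ln 2 * beta * n%:R))]) ->
  0 <= alpha <= beta -> upper_frostman_regular alpha nu.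
Proof.
move=> cg g0 [nufin nucvg] K0 hK /andP[alpha0 alphabeta].
pose X n := K * expR (- (ln 2 * beta * n%:R)).
have X0 n : 0 <= X n by rewrite mulr_ge0// expR_ge0.
have mitv (i : interval R) : measurable ([set` i] : set (measurableTypeR R)).
  exact: measurable_itv.
have nu_le a b n : b - a <= 2 ^- n -> (nu `[a, b]%classic <= (7 * X n)%:E)%E.
  move=> ban.
  have mbump D : measurable_fun (D : set (measurableTypeR R)) (bump a n).
    apply: measurable_funTS.
    exact: continuous_measurable_fun (@continuous_bump a n).
  have n0 : 0 < 2 ^+ n :> R by rewrite exprn_gt0.
  apply: (@le_trans _ _ (\int[nu]_x (bump a n x)%:E)%E).
    rewrite -[X in nu X]setIT -integral_indic//.
    apply: ge0_le_integral => //.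
    - by apply/measurable_EFinP/measurable_indic.
    - by apply/measurable_EFinP; exact: mbump.
    - move=> x _; rewrite lee_fin indicE.
      case: (boolP (_ \in _)) => [|_]; last first.
        by rewrite bump_ge0.
      rewrite inE/= in_itv/= => /andP[ax xb].
      rewrite le_max le_min lexx/=; apply/orP; right.
      rewrite ger0_norm ?subr_ge0// lerBrDl -lerBrDr.
      have -> : 2 - 1 = 2 ^+ n * 2 ^- n :> R.
        by rewrite divff ?gt_eqF//; lra.
      by rewrite ler_wpM2l ?(ltW n0)// (le_trans _ ban)// lerD2r.
  have /(_ (@continuous_bump a n)) := nucvg (bump a n).
  have bd : exists C, forall x, `|bump a n x| <= C.
    by exists 1 => x; rewrite ger0_norm ?bump_ge0 ?bump_le1.
  (* The limit of the integrals equals their lower limit, so a bound for infinitely many cut-offs m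
     is enough. *)
  move=> /(_ bd) /cvg_limn_einf_sup[<- _].
  apply: limn_einf_le_frequently => m0.
  have [m m0m hm] := hK (maxn m0 n).
  have /andP[m0m' nm] : (m0 <= m)%N && (n <= m)%N by rewrite -geq_max.
  exists m => //.
  have [|M ME] := @density_measure R (g m) _ (g0 m).
    exact: (subspace_continuous_measurable_fun (measurable_itv _) (cg m)).
  rewrite (_ : (fun A => _) = M); last first.
    by apply/funext => A; rewrite ME.
  have cells k : (k < 2 ^ n)%N ->
      (\int[leb]_(t in cell_itv n k) (g m t)%:E <= (X n)%:E)%E.
    move=> kn; apply: integral_cell_le => // N0.
    have [N [N0N mN hN]] := hm N0; exists N; split => //.
      exact: leq_trans mN.
    exact: hN.
  apply: le_trans (density_measure_window a ME (X0 n) cells).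
  set J : set (measurableTypeR R) := [set x | _].
  have mJ : measurable J by exact: measurable_ball_le.
  rewrite -[X in M X]setIT -integral_indic//.
  apply: ge0_le_integral => //.
  - by move=> x _; rewrite lee_fin bump_ge0.
  - by apply/measurable_EFinP; exact: mbump.
  - by apply/measurable_EFinP/measurable_indic.
  - move=> x _; rewrite lee_fin indicE; case: (boolP (_ \in _)) => [_|].
      exact: bump_le1.
    rewrite notin_setE /J /= => /negP; rewrite -ltNge => xJ.
    rewrite ge_max lexx/= ge_min; apply/orP; right.
    by rewrite subr_le0 mulrC -ler_pdivrMr// ltW.
apply: (@le_lt_trans _ _ (maxe (nu setT)
    (7 * K * expR (ln 2 * beta))%:E)); last by rewrite gt_max nufin ltry.
apply: ge_ereal_sup => _ [a [b [ba [bb [ab ->]]]]].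
have ab0 : 0 < b - a by rewrite subr_gt0.
have inv_ge0 : (0 <= ((b - a) `^ alpha)^-1%:E)%E.
  by rewrite lee_fin invr_ge0 powR_ge0.
(* Intervals longer than 1 are handled by the total mass, since (b - a)^alpha >= 1. *)
rewrite le_max; have [ba1|ba1] := ltP 1 (b - a); apply/orP.
  left; rewrite -[leRHS]mule1; apply: lee_pmul => //.
    by apply: le_measure; rewrite ?inE.
  rewrite lee_fin invf_le1 ?powR_gt0//.
  have := ge0_ler_powR alpha0 _ _ (ltW ba1).
  by rewrite powR1; apply; rewrite nnegrE ltW.
right.
(* N is taken so large that 2^-N < b - a, which excludes the terminal scale of [dyadic_scale]. *)
have [n /andP[n1 n2]] : exists n, (b - a <= 2 ^- n) && (2 ^- n.+1 <= b - a).
  have [N hN] := exprV2_lt ab0.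
  have [|j _ /andP[j1 /orP[/eqP jN|j2]]] := @dyadic_scale R 0 N (b - a) isT.
  - by rewrite expr0 invr1.
  - by move: j1; rewrite jN leNgt hN.
  - by exists j; rewrite j1 j2.
apply: (@le_trans _ _ ((7 * X n)%:E * ((b - a) `^ alpha)^-1%:E)%E).
  rewrite lee_wpmul2r//; apply: le_trans (nu_le a b n n1).
  apply: le_measure; rewrite ?inE// => x /=; rewrite !in_itv.
  by case: ba; case: bb => /= /andP[h1 h2]; rewrite ?h1 ?h2 ?ltW.
rewrite -EFinM lee_fin ler_pdivrMr ?powR_gt0// /X -!mulrA ler_wpM2l//.
rewrite ler_wpM2l//.
(* The length is bounded below by 2^-(n+1) only; passing from level n to n + 1 costs the factor
   2^beta. *)
apply: (@le_trans _ _ (expR (ln 2 * beta) * (2 ^- n.+1) `^ beta)).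
  have -> : (2 ^- n.+1) `^ beta = expR (- (ln 2 * beta * n.+1%:R)) :> R.
    rewrite /powR gt_eqF ?invr_gt0 ?exprn_gt0// lnV ?posrE ?exprn_gt0// lnXn//.
    by congr expR; rewrite -mulr_natl; ring.
  by rewrite -expRD ler_expR -natr1; lra.
rewrite ler_wpM2l ?expR_ge0//; have beta0 := le_trans alpha0 alphabeta.
apply: (@le_trans _ _ ((b - a) `^ beta)).
  by rewrite ge0_ler_powR ?nnegrE ?invr_ge0 ?exprn_ge0// ltW.
by rewrite ger_powR// ab0.
Qed.

End frostman.

(** With q = 1 + p, the attainable exponent (1 - 1/q)(1 - gamma^2 q / 2) is maximal at q = sqrt 2 /
    gamma, with value (sqrt 2 - gamma)^2 / 2. When this q exceeds 2, the cap q = 2 gives (1 -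
    gamma^2) / 2. These are the two branches of [D_gamma], halved. *)
Lemma frostman_exponent (R : realType) (gamma : R) : 0 < gamma < Num.sqrt 2 ->
  exists2 p : R, 0 < p <= 1 & gamma ^+ 2 * (1 + p) < 2 /\
    forall alpha, alpha < D_gamma gamma / 2 ->
      alpha * (1 + p) < p * (1 - gamma ^+ 2 * (1 + p) / 2).
Proof.
rewrite /D_gamma; set s := Num.sqrt 2 => /andP[gamma0 gamma_s].
have s0 : 0 < s by rewrite sqrtr_gt0.
have s2 : s * s = 2 by rewrite -expr2 sqr_sqrtr.
case: ltP => gs.
  exists 1; first by rewrite ltr01 lexx.
  split; first by nra.
  by move=> alpha; lra.
exists (s / gamma - 1).
  by rewrite subr_gt0 ltr_pdivlMr// mul1r gamma_s/= lerBlDr ler_pdivrMr//; lra.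
rewrite addrC subrK.
have -> : gamma ^+ 2 * (s / gamma) = gamma * s by field; rewrite gt_eqF.
split; first by nra.
move=> alpha h.
(* Writing 1 as s * s / 2 turns the second factor into s (s - gamma) / 2, which completes the
   square. *)
have -> : (s / gamma - 1) * (1 - gamma * s / 2) =
    (s - gamma) ^+ 2 / 2 * (s / gamma).
  rewrite -[X in X - gamma * s / 2](_ : s * s / 2 = 1); last first.
    by rewrite s2 divff.
  by field; rewrite gt_eqF.
by rewrite ltr_pM2r// divr_gt0.
Qed.

(** * The continuous version of the field, and the conclusion for the chaos measure *)

Section gmc.
Context {R : realType} d (T : measurableType d) (P : probability T R).
Variable W : set (measurableTypeR R * measurableTypeR R) ->
  {RV P >-> measurableTypeR R}.
Variable psi : nat -> R -> {RV P >-> measurableTypeR R}.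
Hypothesis noiseW : white_noise W.
Hypothesis versionW : continuous_version W psi.

Lemma expectation_sqr_version m (t : R) : t \in `[0, 1] ->
  ('E_P[fun w => (psi m t w ^+ 2)%R] = (cone_mass m)%:E)%E.
Proof.
move=> t01; have [_ cov] := noiseW; have [ae_eqW _] := versionW.
rewrite -(control_measure_cone m t) -[cone m t]setIid.
rewrite -cov; [|exact: admissible_cone..].
rewrite unlock; apply: ae_eq_integral => //.
- apply/measurable_EFinP/measurable_funX.
  exact: (@measurable_funPT _ _ _ _ (psi m t)).
- by apply/measurable_EFinP/measurable_funM;
    exact: (@measurable_funPT _ _ _ _ (W _)).
- by apply: filterS (ae_eqW m t t01) => w /= -> _.
Qed.

Lemma approx_chaosE gamma m w (A : set (measurableTypeR R)) :
  approx_chaos psi gamma m w A =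
  (\int[lebesgue_measure]_(t in A `&` `[0%R, 1%R])
     (expR (gamma * psi m t w - gamma ^+ 2 / 2 * cone_mass m))%:E)%E.
Proof.
apply: eq_integral => t; rewrite inE => -[_ t01].
by rewrite expectation_sqr_version.
Qed.

Lemma continuous_chaos gamma m w :
  {within `[0, 1], continuous
    (fun t : R => expR (gamma * psi m t w - gamma ^+ 2 / 2 * cone_mass m))}.
Proof.
have [_ cpsi] := versionW; apply/subspace_continuousP => t t01.
have cpsit := (subspace_continuousP _ _).1 (cpsi m w) t t01.
apply: (cvg_comp _ (@expR R)); last exact: continuous_expR.
apply: cvgB; last exact: cvg_cst.
by apply: cvgM; [exact: cvg_cst|exact: cpsit].
Qed.

(** The version agrees with the noise almost surely for each single t; countability of the dyadic
    points gives one common null set. *)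
Lemma ae_version_grid : {ae P, forall w, forall m N i, (i <= 2 ^ N)%N ->
  psi m (grid N i) w = W (cone m (grid N i)) w}.
Proof.
apply: ae_foralln => m; apply: ae_foralln => N; apply: ae_foralln => i.
have [iN|iN] := leqP i (2 ^ N); last exact: filterE.
have [ae_eqW _] := versionW.
apply: filterS (ae_eqW m (grid N i) _) => [w -> //|].
by rewrite in_itv/= grid_ge0 grid_le1.
Qed.

Lemma chaos_sum_version gamma m N n k w :
  (forall i, (i <= 2 ^ N)%N -> psi m (grid N i) w = W (cone m (grid N i)) w) ->
  (n <= N)%N -> (k < 2 ^ n)%N ->
  chaos_sum W gamma m N n k w = \sum_(i <- cell N n k) 2 ^- N *
    expR (gamma * psi m (grid N i) w - gamma ^+ 2 / 2 * cone_mass m).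
Proof.
move=> psiW nN kn; apply: eq_big_seq => i.
rewrite mem_index_iota => /andP[_ iN]; rewrite psiW//.
apply: leq_trans (ltnW iN) _.
by rewrite -{2}(subnKC nN) expnD leq_mul2r kn orbT.
Qed.

End gmc.

Theorem corollary1p2 (R : realType) (d : measure_display)
    (T : measurableType d) (P : probability T R)
    (W : set (measurableTypeR R * measurableTypeR R) ->
         {RV P >-> measurableTypeR R})
    (psi : nat -> R -> {RV P >-> measurableTypeR R})
    (gamma : R) (mu : R.-ker T ~> measurableTypeR R) :
  white_noise W ->
  continuous_version W psi ->
  0 < gamma < Num.sqrt 2 ->
  is_gmc psi gamma mu ->
  {ae P, forall w, forall alpha : R,
     0 <= alpha < D_gamma gamma / 2 -> upper_frostman_regular alpha (mu w)}.
Proof.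
move=> noiseW versionW gamma0 gmc.
have [p p01 [gamma_p alpha_p]] := frostman_exponent gamma0.
(* A countable family of exponents tending to D_gamma / 2 lets a single null set serve every
   alpha. *)
pose beta (l : nat) := D_gamma gamma / 2 - l.+1%:R^-1.
have betaD l : beta l < D_gamma gamma / 2 by rewrite ltrBlDr ltrDl invr_gt0.
have bounded := ae_foralln (fun l =>
  ae_chaos_sum_bounded noiseW p01 gamma_p (alpha_p _ (betaD l))).
have grids := ae_version_grid versionW.
near=> w.
move=> alpha /andP[alpha0 alphaD].
have [l alphal] : exists l, alpha <= beta l.
  have del0 : 0 < D_gamma gamma / 2 - alpha by rewrite subr_gt0.
  exists (Num.truncn (D_gamma gamma / 2 - alpha)^-1).
  rewrite lerBrDl -lerBrDr -[leRHS]invrK lef_pV2 ?posrE ?invr_gt0//.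
  have inv0 : 0 <= (D_gamma gamma / 2 - alpha)^-1 by rewrite invr_ge0 ltW.
  by have /andP[_ /ltW] := truncn_itv inv0.
have gridw : forall m N i, (i <= 2 ^ N)%N ->
  psi m (grid N i) w = W (cone m (grid N i)) w by near: w.
have [K [K0 hK]] : exists K : R, 0 <= K /\
  forall m0, exists2 m, (m0 <= m)%N &
    forall N0, exists N, [/\ (N0 <= N)%N, (m <= N)%N &
      forall n k, (n <= m)%N -> (k < 2 ^ n)%N ->
        chaos_sum W gamma m N n k w <= K * expR (- (ln 2 * beta l * n%:R))].
  (* The index l depends on alpha, which is introduced after w; generalizing over l recovers the
     almost sure event [bounded]. *)
  by move: l {alphal}; near: w.
have cvgw : weakly_converges (fun m => approx_chaos psi gamma m w) (mu w).
  by near: w.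
pose g m t := expR (gamma * psi m t w - gamma ^+ 2 / 2 * cone_mass m).
apply: (@upper_frostman_of_cells _ g (mu w) K (beta l)).
- by move=> m; exact: (@continuous_chaos _ _ _ _ _ _ versionW gamma m w).
- by move=> m t; exact: expR_ge0.
- rewrite (_ : (fun m A => _) = (fun m => approx_chaos psi gamma m w)).
    exact: cvgw.
  apply/funext => m; apply/funext => A.
  by rewrite (approx_chaosE noiseW versionW).
- exact: K0.
- move=> m0; have [m m0m hm] := hK m0; exists m; first exact: m0m.
  move=> N0; have [N [N0N mN hN]] := hm N0; exists N; split.
  + exact: N0N.
  + exact: mN.
  move=> n k nm kn.
  rewrite -(chaos_sum_version gamma (gridw m N) (leq_trans nm mN) kn).
  exact: hN.
- by rewrite alpha0.
Unshelve. all: by end_near.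
Qed.
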